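(* Let $\varphi: M^2 \to N^4(\epsilon)$ be a non-CMC W-surface with flat normal bundle. Assume that $3 f^2 + K - \epsilon \neq 0$ and $\nabla^\perp E_3 \neq 0$ at any point. If $M$ has constant Gaussian curvature $K = \epsilon$, then it cannot be biharmonic.
   Context: $N^4(\epsilon)$, $\epsilon\in\mathbb R$, is the 4-dimensional space form (complete, simply connected) of constant sectional curvature $\epsilon$. Manifolds are connected and immersions are isometric. For a surface $\varphi:M^2\to N^4(\epsilon)$: $B$ is the second fundamental form, $A_\eta$ the shape operator in the normal direction $\eta$, $\nabla^\perp$ the normal connection, $\Delta^\perp=-\operatorname{trace}(\nabla^\perp\nabla^\perp-\nabla^\perp_\nabla)$, $H=\frac12\operatorname{trace}B$, $f=|H|$, $K$ the Gaussian curvature, $E_3=H/f$, $A_3=A_{E_3}$. Flat normal bundle means the curvature of $\nabla^\perp$ vanishes. The surface is biharmonic (vanishing bitension field) if and only if $2\operatorname{trace}A_{\nabla^\perp_{(\cdot)}H}(\cdot)+\operatorname{grad}|H|^2=0$ and $\Delta^\perp H+\operatorname{trace}B(\cdot,A_H(\cdot))-2\epsilon H=0$. A W-surface is one for which there is a smooth $W:\mathbb R^2\to\mathbb R$ with nowhere zero gradient such that $W(f,K)=0$ on $M$. ''Non-CMC'' here means $H\neq0$, $\operatorname{grad}f\neq0$ and $A_3\neq f\,\mathrm{Id}$ at every point. *)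

(* Defs.v *)
From HB Require Import structures.
From mathcomp Require Import all_boot all_order all_algebra.
From mathcomp Require Import all_classical all_reals all_analysis.
Import Order.TTheory GRing.Theory Num.Theory.
Import numFieldNormedType.Exports.

Set Implicit Arguments.
Unset Strict Implicit.
Unset Printing Implicit Defensive.

Local Open Scope classical_set_scope.
Local Open Scope ring_scope.

Section Smooth.
Variables (R : realType) (m : nat).

Definition pd (W : normedModType R) (i : 'I_m) (F : 'rV[R]_m -> W) :
  'rV[R]_m -> W := fun p => 'D_(delta_mx 0 i) F p.

(* Meant for open U: only the germs of F at the points of U matter. *)
Fixpoint Ck (W : normedModType R) (k : nat) (U : set 'rV[R]_m)
    (F : 'rV[R]_m -> W) : Prop :=
  match k with
  | 0 => forall p, U p -> {for p, continuous F}
  | k'.+1 => (forall p, U p -> differentiable F p) /\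
             (forall i : 'I_m, Ck k' U (pd i F))
  end.

Definition smooth_on (W : normedModType R) (U : set 'rV[R]_m)
    (F : 'rV[R]_m -> W) : Prop := forall k, Ck k U F.

End Smooth.

Section Surfaces.
Variables (R : realType) (M : topologicalType).

(* A homeomorphism from the open set chart_dom of M onto the open set chart_img
   of the plane, with inverse chart_inv; the values of chart_map outside
   chart_dom and of chart_inv outside chart_img are irrelevant. *)
Record chart := Chart {
  chart_dom : set M ;
  chart_img : set 'rV[R]_2 ;
  chart_map : M -> 'rV[R]_2 ;
  chart_inv : 'rV[R]_2 -> M ;
  chart_dom_open : open chart_dom ;
  chart_img_open : open chart_img ;
  chart_mapP : forall x, chart_dom x -> chart_img (chart_map x) ;
  chart_invP : forall p, chart_img p -> chart_dom (chart_inv p) ;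
  chart_mapK : forall x, chart_dom x -> chart_inv (chart_map x) = x ;
  chart_invK : forall p, chart_img p -> chart_map (chart_inv p) = p ;
  chart_map_cont : forall x, chart_dom x -> {for x, continuous chart_map} ;
  chart_inv_cont : forall p, chart_img p -> {for p, continuous chart_inv}
}.

Definition smooth_atlas (atlas : set chart) : Prop :=
  (forall x, exists2 c, atlas c & chart_dom c x) /\
  (forall c c', atlas c -> atlas c' ->
     smooth_on (chart_img c `&` chart_inv c @^-1` chart_dom c')
               (chart_map c' \o chart_inv c)).

(* MathComp-Analysis counts the empty set as connected, hence the nonemptiness
   clause. *)
Definition connected_surface (atlas : set chart) : Prop :=
  [/\ hausdorff_space M, @second_countable M, [set: M] !=set0,
      connected [set: M] & smooth_atlas atlas].

End Surfaces.

(* Standard models of N^4(eps) in R^5: the affine hyperplane x_0 = 0 if eps = 0,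
   the round sphere <x, x> = 1/eps if eps > 0, and the upper sheet of the
   hyperboloid <x, x> = 1/eps in Lorentz-Minkowski space (x_0 timelike) if
   eps < 0. *)
Section SpaceForm.
Variables (R : realType) (eps : R).

Definition ip (u v : 'rV[R]_5) : R :=
  (if eps < 0 then -1 else 1) * u 0 ord0 * v 0 ord0
  + \sum_(i < 5 | i != ord0) u 0 i * v 0 i.

Definition space_form : set 'rV[R]_5 :=
  [set x : 'rV[R]_5 | if eps == 0 then x 0 ord0 = 0
           else ip x x = eps^-1 /\ (eps < 0 -> 0 < x 0 ord0)].

Definition space_form_tangent (x : 'rV[R]_5) : set 'rV[R]_5 :=
  [set v : 'rV[R]_5 | if eps == 0 then v 0 ord0 = 0 else ip x v = 0].

(* R^N(X, Y)Z for constant curvature eps. *)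
Definition space_form_curv (u v w : 'rV[R]_5) : 'rV[R]_5 :=
  eps *: (ip v w *: u - ip u w *: v).

End SpaceForm.

(* Local geometry of a parametrized surface X : U -> N^4(eps), U open in the
   plane, endowed with the induced metric.  Vector fields along X are maps from
   the plane to R^5. *)
Section LocalGeometry.
Variables (R : realType) (eps : R) (X : 'rV[R]_2 -> 'rV[R]_5).

Local Notation "<< u , v >>" := (ip eps u v).
Local Notation plane := 'rV[R]_2.
Local Notation vfield := (plane -> 'rV[R]_5).

Definition metric (p : plane) : 'M[R]_2 :=
  \matrix_(i, j) << pd i X p, pd j X p >>.

Definition metric_inv (p : plane) : 'M[R]_2 := invmx (metric p).

Definition gtrace (p : plane) (b : 'I_2 -> 'I_2 -> 'rV[R]_5) : 'rV[R]_5 :=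
  \sum_i \sum_j metric_inv p i j *: b i j.

(* christoffel k i j = Gamma^k_(ij) *)
Definition christoffel (k i j : 'I_2) (p : plane) : R :=
  2^-1 * \sum_l metric_inv p k l *
    (pd i (fun q => metric q j l) p + pd j (fun q => metric q i l) p
     - pd l (fun q => metric q i j) p).

(* riemann l i j k = the d_l-component of R(d_i, d_j) d_k, where
   R(Y, Z) = [nabla_Y, nabla_Z] - nabla_[Y, Z] *)
Definition riemann (l i j k : 'I_2) (p : plane) : R :=
  pd i (christoffel l j k) p - pd j (christoffel l i k) p
  + \sum_m (christoffel l i m p * christoffel m j k p
            - christoffel l j m p * christoffel m i k p).

(* <R(d_0, d_1) d_1, d_0> / det g *)
Definition gauss_curv (p : plane) : R :=
  (\sum_l riemann l ord0 ord_max ord_max p * metric p l ord0) / \det (metric p).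

(* Coordinates of grad h in the frame d_0, d_1. *)
Definition grad (h : plane -> R) (p : plane) : 'rV[R]_2 :=
  \row_k \sum_j metric_inv p k j * pd j h p.

(* The Levi-Civita connection of N^4(eps) pulled back along X: the component of
   d_i V tangent to N^4(eps), for V tangent to N^4(eps) along X. *)
Definition conn (i : 'I_2) (V : vfield) : vfield :=
  fun p => pd i V p + (eps * << pd i X p, V p >>) *: X p.

(* Gauss formula: B(d_i, d_j) = conn_(d_i) d_j - nabla_(d_i) d_j *)
Definition sff (i j : 'I_2) : vfield :=
  fun p => conn i (pd j X) p - \sum_k christoffel k i j p *: pd k X p.

Definition normal_part (p : plane) (v : 'rV[R]_5) : 'rV[R]_5 :=
  v - \sum_i \sum_j (metric_inv p i j * << v, pd i X p >>) *: pd j X p.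

Definition nconn (i : 'I_2) (V : vfield) : vfield :=
  fun p => normal_part p (conn i V p).

Definition mean_curv : vfield := fun p => 2^-1 *: gtrace p (fun i j => sff i j p).

Definition mean_curv_norm (p : plane) : R :=
  Num.sqrt << mean_curv p, mean_curv p >>.

Definition E3 : vfield := fun p => (mean_curv_norm p)^-1 *: mean_curv p.

(* Row i holds the coordinates of A_eta d_i in the frame d_0, d_1, where
   <A_eta d_i, d_j> = <B(d_i, d_j), eta>. *)
Definition shape (eta : vfield) (p : plane) : 'M[R]_2 :=
  (\matrix_(i, j) << sff i j p, eta p >>) *m metric_inv p.

Definition normal_field (U : set plane) (eta : vfield) : Prop :=
  smooth_on U eta /\
  forall p, U p -> space_form_tangent eps (X p) (eta p) /\
                   forall i : 'I_2, << eta p, pd i X p >> = 0.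

(* R^perp(d_i, d_j) eta; the bracket term vanishes for coordinate fields. *)
Definition normal_curv (i j : 'I_2) (eta : vfield) : vfield :=
  fun p => nconn i (nconn j eta) p - nconn j (nconn i eta) p.

(* tau = trace (nabla d(phi)), where (nabla d(phi))(d_i, d_j) = sff i j *)
Definition tension : vfield := fun p => gtrace p (fun i j => sff i j p).

(* The Laplacian - trace (nabla nabla - nabla_nabla) on sections of the
   pullback of the tangent bundle of N^4(eps). *)
Definition rough_laplacian (V : vfield) : vfield := fun p =>
  - gtrace p (fun i j =>
      conn i (conn j V) p - \sum_k christoffel k i j p *: conn k V p).

Definition bitension : vfield := fun p =>
  - rough_laplacian tension p
  - gtrace p (fun i j => space_form_curv eps (pd i X p) (tension p) (pd j X p)).

End LocalGeometry.

Section ImmersedSurfaces.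
Variables (R : realType) (eps : R) (M : topologicalType).
Variables (atlas : set (chart R M)) (phi : M -> 'rV[R]_5).

(* The pointwise property P X p of parametrizations holds at every point of M,
   in every chart around it. *)
Definition everywhere (P : ('rV[R]_2 -> 'rV[R]_5) -> 'rV[R]_2 -> Prop) : Prop :=
  forall c, atlas c -> forall p, chart_img c p -> P (phi \o chart_inv c) p.

(* M carries the metric induced by phi, so phi is isometric by construction. *)
Definition immersion_in_space_form : Prop :=
  [/\ forall x, space_form eps (phi x),
      forall c, atlas c -> smooth_on (chart_img c) (phi \o chart_inv c)
    & everywhere (fun X p => row_free ('J X p))].

Definition nonCMC : Prop := everywhere (fun X p =>
  [/\ mean_curv eps X p != 0,
      grad eps X (mean_curv_norm eps X) p != 0
    & shape eps X (E3 eps X) p != (mean_curv_norm eps X p)%:M]).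

Definition W_surface : Prop :=
  exists W : 'rV[R]_2 -> R,
    [/\ smooth_on setT W,
        forall x, \row_i pd i W x != 0
      & everywhere (fun X p =>
          W (\row_(i < 2) if i == ord0 then mean_curv_norm eps X p
                          else gauss_curv eps X p) = 0)].

Definition flat_normal_bundle : Prop :=
  forall c, atlas c -> forall eta,
    normal_field eps (phi \o chart_inv c) (chart_img c) eta ->
    forall p, chart_img c p ->
    forall i j, normal_curv eps (phi \o chart_inv c) i j eta p = 0.

Definition E3_nowhere_parallel : Prop := everywhere (fun X p =>
  exists i, nconn eps X i (E3 eps X) p != 0).

Definition biharmonic : Prop := everywhere (fun X p => bitension eps X p = 0).

End ImmersedSurfaces.

(* Main.v *)
Require Import Defs.
From HB Require Import structures.
From mathcomp Require Import all_boot all_order all_algebra.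
From mathcomp Require Import all_classical all_reals all_analysis.
From mathcomp Require Import ring lra.
Import Order.TTheory GRing.Theory Num.Theory.
Import numFieldNormedType.Exports.
Local Open Scope classical_set_scope.
Local Open Scope ring_scope.

Set Implicit Arguments.
Unset Strict Implicit.
Unset Printing Implicit Defensive.

(** Write f for the norm of H. Flatness of the normal bundle makes all shape
operators commute, so over a small open set there are orthonormal frames e1, e2
of the surface and e3 = H / f, e4 of its normal bundle in which the shape
operators are A_3 = diag (f + a, f - a) and A_4 = diag (b, - b); here a vanishes
nowhere because A_3 is not f Id. As K is the curvature of the ambient space, the
Gauss equation reduces to a^2 + b^2 = f^2 [gauss_extrinsic].

Write f1, f2 for the derivatives of f along the frame, al and be for the
connection coefficients of the surface and (w1, w2) for the normal connection
form. The tangential part of the biharmonic equation is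
(2 f + a) f1 = - f b w1 and (2 f - a) f2 = f b w2, and it forces b <> 0 [nz_b].
Differentiating a^2 + b^2 = f^2 and inserting the Codazzi equations gives
2 f al = 3 f2 and 2 f be = 3 f1 [d2f_al, d1f_be]. Now all first
derivatives of a and b and all connection coefficients are expressions in f, a, b,
f1, f2, and the closedness of the normal connection
form collapses to f1 f2 = 0 [d1f_d2f]. Where f1 <> 0, the function f2 vanishes to
first order, and the two normal parts of the biharmonic equation together with
the intrinsic Gauss equation leave the algebraic relation
eps (2 f - a) = f (f - a)^2 [relation_at]. Its derivative along e1 is a second
such relation, and the two give 7 f = 3 a, which contradicts |a| < f. Hence
f1 = 0 everywhere [d1f_eq0]; exchanging e1 and e2, also f2 = 0
[bih_system_false], although grad f vanishes nowhere.

Smooth functions on an open set of the plane form a commutative ring with two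
commuting derivations [der_comm]. The geometry of the surface is developed over
this ring: vector fields along the surface are row vectors with entries in it, and
the equations of Gauss, Codazzi and Ricci are instances of one consequence of
Cartan's structure equation [structure_eq]. Only divisions and signs are treated
by evaluation at points.

The frame has to be smooth. Its tangent part is an eigenvector of A_3 given by an
explicit formula, which is nonzero near a given point for a suitable choice of
the sign of a [exists_piv], and e4 is the normalized normal derivative of e3,
which is nonzero in some coordinate direction as e3 is nowhere parallel. After
shrinking the domain both work everywhere [local_biharmonic_false]. *)

(** * Sums over two indices and linear combinations of equations *)

Lemma I2_ind (P : 'I_2 -> Prop) : P ord0 -> P ord_max -> forall i, P i.
Proof.
move=> P0 P1 [[|[|//]] i2]; first by rewrite (_ : Ordinal i2 = ord0)//; exact: val_inj.
by rewrite (_ : Ordinal i2 = ord_max)//; exact: val_inj.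
Qed.

Lemma sumI2 (V : nmodType) (F : 'I_2 -> V) : \sum_a F a = F ord0 + F ord_max.
Proof.
by rewrite !big_ord_recl big_ord0 addr0 (_ : lift ord0 ord0 = ord_max)//; exact: val_inj.
Qed.

Lemma det_mx2 (C : comNzRingType) (M : 'M[C]_2) : \det M =
  M ord0 ord0 * M ord_max ord_max - M ord0 ord_max * M ord_max ord0.
Proof.
rewrite (expand_det_row _ ord0) !big_ord_recl big_ord0 addr0.
rewrite /cofactor !det_mx11 !mxE /= expr0 expr1 mul1r.
have -> : lift ord0 (0 : 'I_1) = ord_max by exact: val_inj.
have -> : lift ord_max (0 : 'I_1) = ord0 by exact: val_inj.
by rewrite mulN1r mulrN.
Qed.

(** With u = v a linear combination of known equations, these lemmas leave the
verification of y = z to [ring]. *)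
Lemma eq_of_sub (V : zmodType) (u v y z : V) : u = v -> y - z = u - v -> y = z.
Proof. by move=> ->; rewrite subrr => /eqP; rewrite subr_eq0 => /eqP. Qed.

Lemma eq_of_subN (V : zmodType) (u v y z : V) : u = v -> y - z = - (u - v) -> y = z.
Proof. by move=> ->; rewrite subrr oppr0 => /eqP; rewrite subr_eq0 => /eqP. Qed.

(** * Calculus of smooth functions of several variables *)

Section Calculus.
Variables (R : realType) (m : nat).
Local Notation space := 'rV[R]_m.
Implicit Types (U : set space) (p : space).

Lemma near_open_eq (W : normedModType R) U (F G : space -> W) p :
  open U -> U p -> (forall q, U q -> F q = G q) -> \near p, F p = G p.
Proof.
by move=> oU Up FG; apply: filterS (open_nbhs_nbhs (conj oU Up)) => q /FG.
Qed.

Lemma pd_congr (W : normedModType R) U (F G : space -> W) i :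
  open U -> (forall q, U q -> F q = G q) -> forall p, U p -> pd i F p = pd i G p.
Proof.
by move=> oU FG p Up; apply: near_eq_derive; apply: near_open_eq FG.
Qed.

Lemma near_eq_differentiable (W : normedModType R) (F G : space -> W) p :
  (\near p, F p = G p) -> differentiable F p -> differentiable G p.
Proof.
move=> FG dF; have cdF := diff_continuous dF.
have GF : (G \o shift p : space -> W) =
    cst (G p) + ('d F p : space -> W) +o_ (0 : space) id.
  apply/eqaddoP => e e0.
  have /eqaddoP/(_ e e0) := diff_locally dF.
  move: FG; rewrite (near_shift 0 p) subr0 => FG oF.
  have FGp : F p = G p by have := nbhs_singleton FG; rewrite /= add0r.
  near=> h.
  have : F (h + p) = G (h + p) by near: h.
  rewrite /= /cst -![(_ - _) h]/(_ - _) -![(_ + _) h]/(_ + _) /= -FGp => <-.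
  by near: h.
have dE : 'd G p = 'd F p :> (space -> W) by apply: diff_unique.
by apply/diff_locallyP; rewrite dE.
Unshelve. all: by end_near. Qed.

Lemma Ck_congr (W : normedModType R) k U (F G : space -> W) :
  open U -> (forall q, U q -> F q = G q) -> Ck k U F -> Ck k U G.
Proof.
move=> oU; elim: k F G => [|k IH] F G FG /= => [cF p Up|[dF cF]].
  have FGp := near_open_eq oU Up FG.
  rewrite /prop_for /continuous_at -(FG p Up); apply: cvg_trans (cF p Up).
  exact: near_eq_cvg FGp.
split=> [p Up|i].
  exact: near_eq_differentiable (near_open_eq oU Up FG) (dF p Up).
by apply: IH (cF i) => p Up; apply: pd_congr FG p Up.
Qed.

Lemma Ck_sub (W : normedModType R) k U V (F : space -> W) :
  V `<=` U -> Ck k U F -> Ck k V F.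
Proof.
move=> VU; elim: k F => [|k IH] F /=; first by move=> cF p /VU/cF.
by move=> [dF cF]; split=> [p /VU/dF//|i]; apply/IH/cF.
Qed.

Lemma CkW (W : normedModType R) k U (F : space -> W) : Ck k.+1 U F -> Ck k U F.
Proof.
elim: k F => [|k IH] F [dF cF]; last by split=> // i; apply/IH/cF.
by move=> p Up; apply/differentiable_continuous/dF.
Qed.

Lemma Ck_pd (W : normedModType R) k U (F : space -> W) :
  Ck k.+1 U F -> forall i, Ck k U (pd i F).
Proof. by case. Qed.

Lemma Ck_cst k U (W : normedModType R) (a : W) : Ck k U (cst a).
Proof.
elim: k a => [|k IH] a /=; first by move=> p _; exact: cst_continuous.
split=> // i; rewrite (_ : pd i _ = cst 0); first exact: IH.
by apply/funext => p; rewrite /pd derive_cst.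
Qed.

Lemma CkD k U (W : normedModType R) (F G : space -> W) :
  open U -> Ck k U F -> Ck k U G -> Ck k U (F \+ G).
Proof.
move=> oU; elim: k F G => [|k IH] F G /= => [cF cG p Up|[dF cF] [dG cG]].
  exact: cvgD (cF _ Up) (cG _ Up).
split=> [p Up|i]; first by apply: differentiableD; [exact: dF|exact: dG].
apply: (Ck_congr oU) (IH _ _ (cF i) (cG i)) => p Up.
by rewrite /pd deriveD//; apply: diff_derivable; [exact: dF|exact: dG].
Qed.

Lemma CkM k U (F G : space -> R) :
  open U -> Ck k U F -> Ck k U G -> Ck k U (F \* G).
Proof.
move=> oU; elim: k F G => [|k IH] F G => [cF cG p Up|CF CG].
  exact: cvgM (cF _ Up) (cG _ Up).
have [[dF cF] [dG cG]] := (CF, CG).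
split=> [p Up|i]; first by apply: differentiableM; [exact: dF|exact: dG].
have := CkD oU (IH _ _ (CkW CF) (cG i)) (IH _ _ (CkW CG) (cF i)).
apply: (Ck_congr oU) => p Up.
by rewrite /pd deriveM//; apply: diff_derivable; [exact: dF|exact: dG].
Qed.

Lemma CkN k U (F : space -> R) : open U -> Ck k U F -> Ck k U (\- F).
Proof.
move=> oU cF; apply: (Ck_congr oU) (CkM oU (Ck_cst k U (-1 : R)) cF) => p _ /=.
by rewrite mulN1r.
Qed.

Lemma CkV k U (F : space -> R) : open U -> (forall p, U p -> F p != 0) ->
  Ck k U F -> Ck k U (fun p => (F p)^-1).
Proof.
move=> oU F0; elim: k => [|k IH] CF; first by move=> p Up; exact: cvgV (F0 p Up) (CF p Up).
have [dF cF] := CF; split=> [p Up|i]; first by apply: differentiableV; [exact: dF|exact: F0].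
have CV := IH (CkW CF).
apply: (Ck_congr oU) (CkM oU (CkN oU (CkM oU CV CV)) (cF i)) => p Up.
rewrite /pd deriveV; [|exact: F0|exact/diff_derivable/dF].
by rewrite /GRing.scale /= expr2 invfM.
Qed.

Lemma Ck_sqrt k U (F : space -> R) : open U -> (forall p, U p -> 0 < F p) ->
  Ck k U F -> Ck k U (fun p => Num.sqrt (F p)).
Proof.
move=> oU F0; elim: k => [|k IH] CF.
  by move=> p Up; apply: (continuous_comp (CF p Up)); exact: sqrt_continuous.
have [dF cF] := CF.
have dS p : U p -> differentiable Num.sqrt (F p).
  by move=> Up; apply/derivable1_diffP; have [] := is_derive1_sqrt (F0 p Up).
split=> [p Up|i]; first exact: differentiable_comp (dF p Up) (dS p Up).
have F20 p : U p -> 2 * Num.sqrt (F p) != 0.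
  by move=> Up; rewrite mulf_neq0 ?pnatr_eq0// gt_eqF// sqrtr_gt0 F0.
have C2 := CkM oU (Ck_cst k U (2 : R)) (IH (CkW CF)).
apply: (Ck_congr oU) (CkM oU (CkV oU F20 C2) (cF i)) => p Up.
rewrite /pd deriveE; last exact: differentiable_comp (dF p Up) (dS p Up).
rewrite diff_comp//=; [|exact: dF|exact: dS].
rewrite -(deriveE _ (dF p Up)) diff1E; last exact: dS.
have [_ d] := is_derive1_sqrt (F0 p Up).
by rewrite derive1E d /GRing.scale /= mulrC.
Qed.

Lemma pd_coord n (F : space -> 'rV[R]_n) i j p : differentiable F p ->
  pd i F p 0 j = pd i (fun q => F q 0 j) p.
Proof.
by move=> dF; rewrite /pd derive_mx ?mxE//; exact: diff_derivable.
Qed.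

Lemma differentiable_coord_comp n (F : space -> 'rV[R]_n) j p :
  differentiable F p -> differentiable (fun q => F q 0 j) p.
Proof.
move=> dF; apply: (@differentiable_comp _ _ _ _ F (fun N : 'rV[R]_n => N 0 j)) => //.
exact: differentiable_coord.
Qed.

Lemma differentiable_row n (F : space -> 'rV[R]_n) p :
  (forall j, differentiable (fun q => F q 0 j) p) -> differentiable F p.
Proof.
move=> dF; rewrite (_ : F = \sum_j (fun q => F q 0 j *: delta_mx 0 j)).
  by apply: differentiable_sum => j; exact: differentiableZl.
by apply/funext => q; rewrite fct_sumE [LHS]row_sum_delta.
Qed.

Lemma smooth_coordP U n (F : space -> 'rV[R]_n) : open U ->
  smooth_on U F <-> forall j, smooth_on U (fun q => F q 0 j).
Proof.
move=> oU; split=> [cF j k|cF k].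
  elim: k F {cF}(cF k) => [|k IH] F.
    move=> cF p Up.
    apply: (@continuous_comp _ _ _ F (fun N : 'rV[R]_n => N 0 j)); first exact: cF.
    exact: coord_continuous.
  move=> [dF cF]; split=> [p /dF /differentiable_coord_comp//|i].
  apply: (Ck_congr oU) (IH _ (cF i)) => p Up.
  by rewrite pd_coord//; exact: dF.
have {}cF : forall j, Ck k.+1 U (fun q => F q 0 j) by move=> j; exact: cF.
elim: k F cF => [|k IH] F cF.
  move=> p Up; apply: differentiable_continuous.
  by apply: differentiable_row => j; exact: (cF j).1.
have dF p : U p -> differentiable F p.
  by move=> Up; apply: differentiable_row => j; apply: (cF j).1.
split=> // i; apply: IH => j; apply: (Ck_congr oU) (Ck_pd (cF j) i) => p Up.
by rewrite pd_coord//; exact: dF.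
Qed.

Lemma is_derive_line (G : space -> R) (q v : space) (t : R) :
  differentiable G (t *: v + q) ->
  is_derive t 1 (fun s => G (s *: v + q)) ('D_v G (t *: v + q)).
Proof.
move=> /diff_derivable dG.
have e : (fun h : R => h^-1 *:
      (((fun s => G (s *: v + q)) \o shift t) (h *: 1) - G (t *: v + q))) =
    (fun h => h^-1 *: ((G \o shift (t *: v + q)) (h *: v) - G (t *: v + q))).
  by apply/funext => h /=; rewrite [h *: 1]mulr1 scalerDl addrA.
by apply: DeriveDef; rewrite /derivable /derive e//; exact: dG.
Qed.

Lemma mean_value_line (G : space -> R) (q v : space) (h : R) : 0 < h ->
  (forall t, 0 <= t <= h -> differentiable G (t *: v + q)) ->
  exists2 t, 0 < t < h & G (h *: v + q) - G q = h * 'D_v G (t *: v + q).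
Proof.
move=> h0 dG.
have d t : t \in `]0, h[ ->
    is_derive t 1 (fun s => G (s *: v + q)) ('D_v G (t *: v + q)).
  rewrite in_itv/= => /andP[t0 th].
  by apply/is_derive_line/dG; rewrite !ltW.
have [|t] := MVT h0 d.
  apply: derivable_within_continuous => t; rewrite in_itv/= => /dG.
  by move=> /is_derive_line[].
by rewrite in_itv/= scale0r add0r subr0 mulrC => th e; exists t.
Qed.

Lemma second_difference (F : space -> R) i j p (h : R)
    (u := delta_mx 0 i : space) (v := delta_mx 0 j : space) : 0 < h ->
  (forall s t, 0 <= s <= h -> 0 <= t <= h ->
     differentiable F (t *: v + (s *: u + p)) /\
     differentiable (pd i F) (t *: v + (s *: u + p))) ->
  exists s t, [/\ 0 < s < h, 0 < t < h &
    F (h *: v + (h *: u + p)) - F (h *: u + p) - (F (h *: v + p) - F p) =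
      h * (h * pd j (pd i F) (t *: v + (s *: u + p)))].
Proof.
move=> h0 dF; have hh : 0 <= h <= h by apply/andP; split=> //; exact: ltW.
have h00 : (0 : R) <= 0 <= h by apply/andP; split=> //; exact: ltW.
pose phi (s : R) := F (s *: u + (h *: v + p)) - F (s *: u + p).
pose dphi (s : R) := pd i F (s *: u + (h *: v + p)) - pd i F (s *: u + p).
have dphiP s : 0 <= s <= h -> is_derive s 1 phi (dphi s).
  move=> sh; apply: is_deriveB; apply: is_derive_line.
    by rewrite addrCA; exact: (dF s h sh hh).1.
  by have := (dF s 0 sh h00).1; rewrite scale0r add0r.
have dphi_in s : s \in `]0, h[ -> is_derive s 1 phi (dphi s).
  by rewrite in_itv/= => /andP[s0 sh]; apply: dphiP; rewrite !ltW.
have cphi : {within `[0, h], continuous phi}.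
  apply: derivable_within_continuous => s; rewrite in_itv/= => /dphiP.
  by case.
have [s] := MVT h0 dphi_in cphi.
rewrite in_itv/= => sh; have [s0 s1] := andP sh.
have sh' : 0 <= s <= h by rewrite !ltW.
rewrite subr0 /phi /dphi !scale0r !add0r => e.
have [|t th et] := @mean_value_line (pd i F) (s *: u + p) v h h0.
  by move=> t th; exact: (dF s t sh' th).2.
exists s, t; split=> //; rewrite -et mulrC [h *: v + (_ + _)]addrCA.
by rewrite [h *: v + (_ + _)]addrCA -e; ring.
Qed.

(** Both iterated partial derivatives are limits of the same second difference
quotient, by two applications of the mean value theorem in either order. *)
Lemma pd_comm U (F : space -> R) i j p : open U -> U p -> Ck 2 U F ->
  pd i (pd j F) p = pd j (pd i F) p.
Proof.
move=> oU Up [dF CF].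
have [dpi dpj] := ((CF i).1, (CF j).1).
have cij : {for p, continuous (pd i (pd j F))}.
  by have [_ /(_ i)] := CF j; apply.
have cji : {for p, continuous (pd j (pd i F))}.
  by have [_ /(_ j)] := CF i; apply.
apply/eqP; rewrite -subr_eq0 -normr_le0; apply/ler_addgt0Pl => e e0.
rewrite addr0.
have e20 : 0 < e / 2 by rewrite divr_gt0.
have nU : nbhs p U by exact: open_nbhs_nbhs.
have nij : \forall q \near p, `|pd i (pd j F) p - pd i (pd j F) q| < e / 2.
  by move/cvgrPdist_lt : cij; apply.
have nji : \forall q \near p, `|pd j (pd i F) p - pd j (pd i F) q| < e / 2.
  by move/cvgrPdist_lt : cji; apply.
have /nbhs_ballP[d /= d0 dP] : nbhs p [set q | [/\ U q,
    `|pd i (pd j F) p - pd i (pd j F) q| < e / 2 &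
    `|pd j (pd i F) p - pd j (pd i F) q| < e / 2]].
  by move: nU nij nji; apply: filterS3 => q.
have [h h0 hd] : exists2 h : R, 0 < h & 2 * h < d.
  by exists (d / 3); move: d0 => /= d0; lra.
have nd k : `|delta_mx 0 k : space| <= 1.
  rewrite /Num.Def.normr/= mx_normrE bigmax_le// => -[a b] _ /=.
  by rewrite mxE; case: (_ && _); rewrite ?normr1 ?normr0.
have inball (k l : 'I_m) s t : 0 <= s <= h -> 0 <= t <= h ->
    ball p d (t *: delta_mx 0 l + (s *: delta_mx 0 k + p)).
  move=> /andP[s0 sh] /andP[t0 th]; rewrite -ball_normE /ball_ /=.
  rewrite addrA (addrC _ p) opprD addrA subrr sub0r normrN (le_lt_trans (ler_normD _ _))//.
  rewrite !normrZ !ger0_norm//.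
  have := ler_pM t0 (normr_ge0 (delta_mx 0 l : space)) th (nd l).
  have := ler_pM s0 (normr_ge0 (delta_mx 0 k : space)) sh (nd k).
  rewrite !mulr1 => sk tl.
  lra.
have [|s [t [/andP[s0 sh] /andP[t0 th] e1]]] := @second_difference F i j p h h0.
  move=> s t sh th; have [Uq _ _] := dP _ (inball i j s t sh th).
  by split; [exact: dF|exact: dpi].
have [|s' [t' [/andP[s0' sh'] /andP[t0' th'] e2]]] := @second_difference F j i p h h0.
  move=> ? ? sh' th'; have [Uq _ _] := dP _ (inball j i _ _ sh' th').
  by split; [exact: dF|exact: dpj].
have lehP x : 0 < x -> x < h -> 0 <= x <= h.
  by move=> x0 xh; rewrite !ltW.
have [_ _] := dP _ (inball i j s t (lehP s s0 sh) (lehP t t0 th)).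
have [_ + _] := dP _ (inball j i s' t' (lehP s' s0' sh') (lehP t' t0' th')).
set q' := pd i (pd j F) (_ + _); set q := pd j (pd i F) (_ + _).
have -> : q' = q.
  have hn : h != 0 by rewrite gt_eqF.
  have e12 : h * (h * q') = h * (h * q).
    apply: etrans (esym e2) _; apply: etrans _ e1.
    rewrite (addrCA (h *: delta_mx 0 i)) !opprB addrACA [RHS]addrACA.
    by congr (_ + _); rewrite addrC.
  exact: mulfI hn _ _ (mulfI hn e12).
move=> a b; apply: le_trans (ler_distD q _ _) _; rewrite [leRHS]splitr.
by apply: lerD; [exact: (ltW a)|rewrite distrC; exact: (ltW b)].
Qed.

End Calculus.

(** * The ring of smooth functions on an open set *)

(** The point makes the ring of smooth functions on the domain nontrivial. *)
Record domain (R : realType) := Domain {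
  dom :> 'rV[R]_2 -> Prop ;
  dom_open : open (dom : set 'rV[R]_2) ;
  dom_pt : 'rV[R]_2 ;
  dom_ptP : dom dom_pt
}.

Arguments dom_open {R} d.

(** The value 0 outside the domain makes Leibniz equality of smooth functions
coincide with equality on the domain. *)
Record sfun (R : realType) (U : domain R) := SFun {
  sfun_val :> 'rV[R]_2 -> R ;
  sfun_smooth : smooth_on U sfun_val ;
  sfun_out : forall p, ~ U p -> sfun_val p = 0
}.

Section SmoothFunctions.
Variables (R : realType) (U : domain R).
Local Notation plane := 'rV[R]_2.
Local Notation A := (sfun U).
Implicit Types p : plane.

HB.instance Definition _ := gen_eqMixin A.
HB.instance Definition _ := gen_choiceMixin A.

Definition cutoff (F : plane -> R) : plane -> R :=
  fun p => if p \in (U : set plane) then F p else 0.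

Lemma cutoffE (F : plane -> R) p : U p -> cutoff F p = F p.
Proof. by move=> Up; rewrite /cutoff mem_set. Qed.

Lemma smooth_cutoff (F : plane -> R) : smooth_on U F -> smooth_on U (cutoff F).
Proof.
move=> sF k; apply: (Ck_congr (dom_open U)) (sF k) => p Up.
by rewrite cutoffE.
Qed.

Lemma cutoff_out (F : plane -> R) p : ~ U p -> cutoff F p = 0.
Proof. by move=> Up; rewrite /cutoff memNset. Qed.

Lemma to_sfun (F : plane -> R) :
  smooth_on U F -> {a : A | forall p, U p -> a p = F p}.
Proof.
by move=> sF; exists (SFun (smooth_cutoff sF) (@cutoff_out F)) => p; exact: cutoffE.
Qed.

Lemma sfunP (a b : A) : (forall p, U p -> a p = b p) -> a = b.
Proof.
move=> ab; have : sfun_val a = sfun_val b.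
  apply/funext => p; have [/ab//|nUp] := pselect (U p).
  by rewrite !sfun_out.
case: a b {ab} => [a sa oa] [b sb ob] /= ab.
by case: _ / ab in sb ob *; congr SFun; exact: Prop_irrelevance.
Qed.

Lemma scst_sig (c : R) : {a : A | forall p, U p -> a p = c}.
Proof. exact: to_sfun (fun k => Ck_cst k U c). Qed.

Lemma sadd_sig (a b : A) : {c : A | forall p, U p -> c p = a p + b p}.
Proof.
exact: to_sfun (fun k => CkD (dom_open U) (sfun_smooth a k) (sfun_smooth b k)).
Qed.

Lemma smul_sig (a b : A) : {c : A | forall p, U p -> c p = a p * b p}.
Proof.
exact: to_sfun (fun k => CkM (dom_open U) (sfun_smooth a k) (sfun_smooth b k)).
Qed.

Lemma sopp_sig (a : A) : {c : A | forall p, U p -> c p = - a p}.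
Proof. exact: to_sfun (fun k => CkN (dom_open U) (sfun_smooth a k)). Qed.

End SmoothFunctions.

HB.lock Definition scst (R : realType) (U : domain R) (c : R) : sfun U :=
  sval (scst_sig U c).
HB.lock Definition sadd (R : realType) (U : domain R) (a b : sfun U) : sfun U :=
  sval (sadd_sig a b).
HB.lock Definition smul (R : realType) (U : domain R) (a b : sfun U) : sfun U :=
  sval (smul_sig a b).
HB.lock Definition sopp (R : realType) (U : domain R) (a : sfun U) : sfun U :=
  sval (sopp_sig a).

Section SmoothRing.
Variables (R : realType) (U : domain R).
Local Notation plane := 'rV[R]_2.
Local Notation A := (sfun U).
Implicit Types p : plane.
Local Notation sadd := (@sadd R U).
Local Notation smul := (@smul R U).
Local Notation sopp := (@sopp R U).
Local Notation scst := (@scst R U).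

Let saddE (a b : A) p : U p -> sadd a b p = a p + b p.
Proof. rewrite sadd.unlock; exact: (svalP (sadd_sig a b)). Qed.
Let smulE (a b : A) p : U p -> smul a b p = a p * b p.
Proof. rewrite smul.unlock; exact: (svalP (smul_sig a b)). Qed.
Let soppE (a : A) p : U p -> sopp a p = - a p.
Proof. rewrite sopp.unlock; exact: (svalP (sopp_sig a)). Qed.
Lemma scstE (c : R) p : U p -> scst c p = c.
Proof. rewrite scst.unlock; exact: (svalP (scst_sig U c)). Qed.
Let evalE := (saddE, smulE, soppE, scstE).

Fact saddA : associative sadd.
Proof. by move=> a b c; apply: sfunP => p Up; rewrite !evalE// addrA. Qed.
Fact saddC : commutative sadd.
Proof. by move=> a b; apply: sfunP => p Up; rewrite !evalE// addrC. Qed.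
Fact sadd0 : left_id (scst 0) sadd.
Proof. by move=> a; apply: sfunP => p Up; rewrite !evalE// add0r. Qed.
Fact saddN : left_inverse (scst 0) sopp sadd.
Proof. by move=> a; apply: sfunP => p Up; rewrite !evalE// addNr. Qed.

HB.instance Definition _ := GRing.isZmodule.Build A saddA saddC sadd0 saddN.

Fact smulA : associative smul.
Proof. by move=> a b c; apply: sfunP => p Up; rewrite !evalE// mulrA. Qed.
Fact smulC : commutative smul.
Proof. by move=> a b; apply: sfunP => p Up; rewrite !evalE// mulrC. Qed.
Fact smul1 : left_id (scst 1) smul.
Proof. by move=> a; apply: sfunP => p Up; rewrite !evalE// mul1r. Qed.
Fact smulDl : left_distributive smul sadd.
Proof.
by move=> a b c; apply: sfunP => p Up; rewrite !evalE// mulrDl.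
Qed.
Fact sone_neq0 : scst 1 != 0.
Proof.
apply/eqP => /(congr1 (fun a : A => a (dom_pt U))).
rewrite !scstE; [|exact: dom_ptP|exact: dom_ptP].
by move/eqP; rewrite oner_eq0.
Qed.

HB.instance Definition _ :=
  GRing.Zmodule_isComNzRing.Build A smulA smulC smul1 smulDl sone_neq0.

Section Evaluation.
Variables (p : plane) (Up : U p).

Lemma sfun0E : (0 : A) p = 0. Proof. exact: scstE. Qed.
Lemma sfun1E : (1 : A) p = 1. Proof. exact: scstE. Qed.
Lemma sfunDE (a b : A) : (a + b) p = a p + b p. Proof. exact: saddE. Qed.
Lemma sfunNE (a : A) : (- a) p = - a p. Proof. exact: soppE. Qed.
Lemma sfunME (a b : A) : (a * b) p = a p * b p. Proof. exact: smulE. Qed.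

Lemma sfun_natE n : (n%:R : A) p = n%:R.
Proof. by elim: n => [|n IH]; rewrite ?sfun0E// !mulrS sfunDE IH sfun1E. Qed.

Lemma sfunXE (a : A) n : (a ^+ n) p = a p ^+ n.
Proof. by elim: n => [|n IH]; rewrite ?expr0 ?sfun1E// !exprS sfunME IH. Qed.

Lemma sfun_sumE I r (P : pred I) (F : I -> A) :
  (\sum_(i <- r | P i) F i) p = \sum_(i <- r | P i) F i p.
Proof.
by elim/big_rec2: _ => [|i x y _ <-]; rewrite ?sfun0E ?sfunDE.
Qed.

End Evaluation.

Definition nowhere0 (a : A) := forall p, U p -> a p != 0.

(** The second clause is the convention of unit rings for the inverse of a
non-unit. *)
Lemma sinv_sig (a : A) : {b : A | (forall p, U p -> nowhere0 a -> b p = (a p)^-1) /\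
  (~ nowhere0 a -> b = a)}.
Proof.
have [a0|na0] := pselect (nowhere0 a); last by exists a; split.
have [b bE] := to_sfun (fun k => CkV (dom_open U) a0 (sfun_smooth a k)).
by exists b; split=> // p Up _; exact: bE.
Qed.

End SmoothRing.

HB.lock Definition sinv (R : realType) (U : domain R) (a : sfun U) : sfun U :=
  sval (sinv_sig a).

Section SmoothUnits.
Variables (R : realType) (U : domain R).
Local Notation plane := 'rV[R]_2.
Local Notation A := (sfun U).
Implicit Types p : plane.
Local Notation sinv := (@sinv R U).

Let sunit : pred A := fun a => `[< nowhere0 a >].

Fact smulV : {in sunit, left_inverse 1 sinv *%R}.
Proof.
move=> a /asboolP a0; apply: sfunP => p Up; rewrite sfunME// sfun1E//.
by rewrite sinv.unlock (svalP (sinv_sig a)).1// mulVf// a0.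
Qed.
Fact sunit_intro (a b : A) : b * a = 1 -> sunit a.
Proof.
move=> ba; apply/asboolP => p Up.
have := congr1 (fun c : A => c p) ba; rewrite sfunME// sfun1E// => bap.
by apply: contra_eq_neq bap => ->; rewrite mulr0 eq_sym oner_eq0.
Qed.
Fact sinv_out : {in [predC sunit], sinv =1 id}.
Proof. by move=> a /asboolPn; rewrite sinv.unlock; exact: (svalP (sinv_sig a)).2. Qed.

HB.instance Definition _ :=
  GRing.ComNzRing_hasMulInverse.Build A smulV sunit_intro sinv_out.

Lemma sunitP (a : A) : reflect (nowhere0 a) (a \is a GRing.unit).
Proof. exact: asboolP. Qed.

Lemma sfunVE (a : A) p : U p -> nowhere0 a -> a^-1 p = (a p)^-1.
Proof.
move=> Up a0; have := congr1 (fun c : A => c p) (mulVr (introT (sunitP a) a0)).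
rewrite sfunME// sfun1E// => e; apply: (mulIf (a0 p Up)).
by rewrite e mulVf// a0.
Qed.

Definition positive (a : A) := forall p, U p -> 0 < a p.

Lemma ssqrt_sig (a : A) :
  {b : A | forall p, U p -> positive a -> b p = Num.sqrt (a p)}.
Proof.
have [a0|na0] := pselect (positive a); last by exists 0.
have [b bE] := to_sfun (fun k => Ck_sqrt (dom_open U) a0 (sfun_smooth a k)).
by exists b => p Up _; exact: bE.
Qed.

Lemma der_sig (i : 'I_2) (a : A) : {b : A | forall p, U p -> b p = pd i a p}.
Proof. exact: to_sfun (fun k => Ck_pd (sfun_smooth a k.+1) i). Qed.

End SmoothUnits.

HB.lock Definition ssqrt (R : realType) (U : domain R) (a : sfun U) : sfun U :=
  sval (ssqrt_sig a).
HB.lock Definition der (R : realType) (U : domain R) (i : 'I_2) (a : sfun U) :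
  sfun U := sval (der_sig i a).

Section Derivations.
Variables (R : realType) (U : domain R).
Local Notation plane := 'rV[R]_2.
Local Notation A := (sfun U).
Implicit Types p : plane.

Lemma ssqrtE (a : A) p : U p -> positive a -> ssqrt a p = Num.sqrt (a p).
Proof. rewrite ssqrt.unlock; exact: (svalP (ssqrt_sig a)). Qed.

Lemma ssqrt_positive (a : A) : positive a -> positive (ssqrt a).
Proof. by move=> a0 p Up; rewrite ssqrtE// sqrtr_gt0 a0. Qed.

Lemma sqr_ssqrt (a : A) : positive a -> ssqrt a ^+ 2 = a.
Proof. by move=> a0; apply: sfunP => p Up; rewrite sfunXE// ssqrtE// sqr_sqrtr// ltW// a0. Qed.

Lemma positive_nowhere0 (a : A) : positive a -> nowhere0 a.
Proof. by move=> a0 p Up; rewrite gt_eqF// a0. Qed.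

Lemma derE i (a : A) p : U p -> der i a p = pd i a p.
Proof. rewrite der.unlock; exact: (svalP (der_sig i a)). Qed.

Lemma sfun_diff (a : A) p : U p -> differentiable a p.
Proof. by move=> Up; apply: (sfun_smooth a 1).1. Qed.

Lemma derD i : {morph @der R U i : a b / a + b}.
Proof.
move=> a b; apply: sfunP => p Up; rewrite sfunDE// !derE//.
rewrite (pd_congr (G := sfun_val a \+ b) i (dom_open U) _ Up).
  by rewrite /pd deriveD//; apply/diff_derivable/sfun_diff.
by move=> q Uq; rewrite sfunDE.
Qed.

Lemma derM i (a b : A) : der i (a * b) = der i a * b + a * der i b.
Proof.
apply: sfunP => p Up; rewrite sfunDE// !sfunME// !derE//.
rewrite (pd_congr (G := sfun_val a \* b) i (dom_open U) _ Up).
  have da := diff_derivable (v := delta_mx 0 i) (sfun_diff a Up).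
  have db := diff_derivable (v := delta_mx 0 i) (sfun_diff b Up).
  by rewrite [LHS](deriveM da db) /GRing.scale/= addrC mulrC.
by move=> q Uq; rewrite sfunME.
Qed.

Lemma der_cst i c : der i (scst U c) = 0.
Proof.
apply: sfunP => p Up; rewrite derE// sfun0E//.
rewrite (pd_congr (G := cst c) i (dom_open U) _ Up); first by rewrite /pd derive_cst.
by move=> q Uq; rewrite scstE.
Qed.

Fact der_zmod_morphism i : zmod_morphism (@der R U i).
Proof.
have d0 : der i (0 : A) = 0 by apply: (addrI (der i (0 : A))); rewrite -derD !addr0.
have dN (a : A) : der i (- a) = - der i a.
  by apply/eqP; rewrite -addr_eq0 -derD addNr d0.
by move=> a b; rewrite derD dN.
Qed.

HB.instance Definition _ i := GRing.isZmodMorphism.Build A A (@der R U i) (der_zmod_morphism i).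

Lemma der1 i : der i (1 : A) = 0. Proof. exact: der_cst. Qed.

(** Schwarz's theorem, at the level of the ring. *)
Lemma der_comm i j (a : A) : der i (der j a) = der j (der i a).
Proof.
apply: sfunP => p Up.
have ij : pd i (der j a) p = pd i (pd j a) p.
  by refine (pd_congr i (dom_open U) _ Up) => q Uq; exact: derE.
have ji : pd j (der i a) p = pd j (pd i a) p.
  by refine (pd_congr j (dom_open U) _ Up) => q Uq; exact: derE.
apply: etrans (derE i _ Up) _; apply: etrans ij _.
apply: etrans _ (esym (derE j _ Up)); apply: etrans _ (esym ji).
exact: pd_comm (dom_open U) Up (sfun_smooth a 2).
Qed.

Lemma half2 : scst U 2^-1 * 2%:R = 1 :> A.
Proof.
apply: sfunP => p Up; rewrite sfunME// scstE// sfun_natE// sfun1E//.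
by rewrite mulVf// pnatr_eq0.
Qed.

Lemma two_inj (y : A) : 2%:R * y = 0 -> y = 0.
Proof. by move=> y0; rewrite -[LHS]mul1r -half2 -mulrA y0 mulr0. Qed.

End Derivations.

(** * Vector fields along a surface *)

HB.lock Definition dot (R : realType) (eps : R) (U : domain R)
    (u v : 'rV[sfun U]_5) : sfun U :=
  scst U (if eps < 0 then -1 else 1) * u 0 ord0 * v 0 ord0
  + \sum_(i < 5 | i != ord0) u 0 i * v 0 i.

HB.lock Definition vder (R : realType) (U : domain R) (i : 'I_2)
    (v : 'rV[sfun U]_5) : 'rV[sfun U]_5 := map_mx (der i) v.

Section VectorFields.
Variables (R : realType) (eps : R) (U : domain R).
Local Notation plane := 'rV[R]_2.
Local Notation A := (sfun U).
Local Notation vec := 'rV[A]_5.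
Local Notation dot := (@dot R eps U).
Local Notation vder := (@vder R U).
Implicit Types (p : plane) (a b : A) (u v w : vec).

(** The proof that p lies in the domain makes evaluation a ring morphism. *)
Definition ev p (Up : U p) : A -> R := fun a => a p.

Section Evaluation.
Variables (p : plane) (Up : U p).

Fact ev_zmod_morphism : zmod_morphism (ev Up).
Proof. by move=> a b; rewrite /ev sfunDE// sfunNE. Qed.
Fact ev_monoid_morphism : monoid_morphism (ev Up).
Proof. by split=> [|a b]; rewrite /ev ?sfun1E// sfunME. Qed.

HB.instance Definition _ := GRing.isZmodMorphism.Build A R (ev Up) ev_zmod_morphism.
HB.instance Definition _ := GRing.isMonoidMorphism.Build A R (ev Up) ev_monoid_morphism.

End Evaluation.

Definition evv p v : 'rV[R]_5 := map_mx (fun a : A => a p) v.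

Lemma dot_def u v : dot u v =
  scst U (if eps < 0 then -1 else 1) * u 0 ord0 * v 0 ord0
  + \sum_(i < 5 | i != ord0) u 0 i * v 0 i.
Proof. by rewrite dot.unlock. Qed.

Lemma vder_coord i v k : vder i v 0 k = der i (v 0 k).
Proof. by rewrite vder.unlock mxE. Qed.

Lemma evvP u v : (forall p, U p -> evv p u = evv p v) -> u = v.
Proof.
move=> uv; apply/rowP => k; apply: sfunP => p Up.
by have /rowP/(_ k) := uv p Up; rewrite !mxE.
Qed.

Section EvaluationVector.
Variables (p : plane) (Up : U p).

Lemma evvD u v : evv p (u + v) = evv p u + evv p v.
Proof. by apply/rowP => k; rewrite !mxE sfunDE. Qed.
Lemma evvN u : evv p (- u) = - evv p u.
Proof. by apply/rowP => k; rewrite !mxE sfunNE. Qed.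
Lemma evvZ a u : evv p (a *: u) = a p *: evv p u.
Proof. by apply/rowP => k; rewrite !mxE sfunME. Qed.
Lemma evv0 : evv p 0 = 0.
Proof. by apply/rowP => k; rewrite !mxE sfun0E. Qed.
Lemma evv_sum I r (P : pred I) (F : I -> vec) :
  evv p (\sum_(i <- r | P i) F i) = \sum_(i <- r | P i) evv p (F i).
Proof. by elim/big_rec2: _ => [|i x y _ <-]; rewrite ?evv0 ?evvD. Qed.
Lemma evv_dot u v : dot u v p = ip eps (evv p u) (evv p v).
Proof.
rewrite dot_def /ip sfunDE// !sfunME// scstE// !mxE sfun_sumE//; congr (_ + _).
by apply: eq_bigr => i _; rewrite sfunME// !mxE.
Qed.

End EvaluationVector.

Lemma dotC u v : dot u v = dot v u.
Proof.
rewrite !dot_def mulrAC; congr (_ + _); apply: eq_bigr => i _; exact: mulrC.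
Qed.

Lemma dotDl u v w : dot (u + v) w = dot u w + dot v w.
Proof.
rewrite !dot_def mxE mulrDr mulrDl addrACA -big_split; congr (_ + _).
by apply: eq_bigr => i _; rewrite mxE mulrDl.
Qed.

Lemma dotZl a u v : dot (a *: u) v = a * dot u v.
Proof.
rewrite !dot_def mxE mulrDr mulr_sumr mulrCA -!mulrA; congr (_ + _).
by apply: eq_bigr => i _; rewrite mxE mulrA.
Qed.

Lemma dotDr u v w : dot u (v + w) = dot u v + dot u w.
Proof. by rewrite dotC dotDl !(dotC u). Qed.
Lemma dotZr a u v : dot u (a *: v) = a * dot u v.
Proof. by rewrite dotC dotZl dotC. Qed.
Lemma dotNl u v : dot (- u) v = - dot u v.
Proof. by rewrite -scaleN1r dotZl mulN1r. Qed.
Lemma dotNr u v : dot u (- v) = - dot u v.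
Proof. by rewrite dotC dotNl dotC. Qed.
Lemma dot0l u : dot 0 u = 0.
Proof. by rewrite -(scale0r 0) dotZl mul0r. Qed.
Lemma dot0r u : dot u 0 = 0. Proof. by rewrite dotC dot0l. Qed.
Lemma dot_suml I r (P : pred I) (F : I -> vec) u :
  dot (\sum_(i <- r | P i) F i) u = \sum_(i <- r | P i) dot (F i) u.
Proof. by elim/big_rec2: _ => [|i x y _ <-]; rewrite ?dot0l ?dotDl. Qed.
Lemma dot_sumr I r (P : pred I) (F : I -> vec) u :
  dot u (\sum_(i <- r | P i) F i) = \sum_(i <- r | P i) dot u (F i).
Proof. by elim/big_rec2: _ => [|i x y _ <-]; rewrite ?dot0r ?dotDr. Qed.

Definition dotE := (dotDl, dotDr, dotNl, dotNr, dotZl, dotZr, dot0l, dot0r).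

Lemma vderD i u v : vder i (u + v) = vder i u + vder i v.
Proof. by rewrite vder.unlock map_mxD. Qed.
Lemma vderZ i a u : vder i (a *: u) = der i a *: u + a *: vder i u.
Proof. by apply/rowP => k; rewrite !(mxE, vder_coord) derM. Qed.
Lemma vder_sum i I r (P : pred I) (F : I -> vec) :
  vder i (\sum_(j <- r | P j) F j) = \sum_(j <- r | P j) vder i (F j).
Proof. by rewrite vder.unlock map_mx_sum. Qed.
Lemma vder_comm i j u : vder i (vder j u) = vder j (vder i u).
Proof. by apply/rowP => k; rewrite !vder_coord der_comm. Qed.

Lemma der_dot i u v : der i (dot u v) = dot (vder i u) v + dot u (vder i v).
Proof.
rewrite !dot_def derD 2!derM der_cst mul0r add0r.
have -> : der i (\sum_(k < 5 | k != ord0) u 0 k * v 0 k) =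
    \sum_(k < 5 | k != ord0) (der i (u 0 k) * v 0 k + u 0 k * der i (v 0 k)).
  by rewrite (raddf_sum (der i)); apply: eq_bigr => k _; exact: derM.
rewrite big_split addrACA; congr (_ + _ + (_ + _)).
- by rewrite vder_coord.
- by apply: eq_bigr => k _; rewrite vder_coord.
- by rewrite vder_coord.
- by apply: eq_bigr => k _; rewrite vder_coord.
Qed.

(** If E is the matrix of the family, J that of the inner product and D that of
the weights, orthogonality says that J E^T D is a right inverse of E, hence a left
inverse as E is square. *)
Lemma orthogonal_expansion (e : 'I_5 -> vec) (wt : 'I_5 -> A) :
  (forall i j, dot (e i) (e j) * wt j = (i == j)%:R) ->
  forall v, v = \sum_i (dot v (e i) * wt i) *: e i.
Proof.
move=> orth v.
pose J : 'M[A]_5 := diag_mx (\row_i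
  (if i == ord0 then scst U (if eps < 0 then -1 else 1) else 1)).
have dotJ u w : (u *m J *m w^T) 0 0 = dot u w.
  rewrite mxE (bigD1 ord0)//= mul_mx_diag !mxE eqxx dot_def.
  rewrite [u 0 ord0 * _]mulrC; congr (_ + _).
  by apply: eq_bigr => i i0; rewrite !mxE (negbTE i0) mulr1.
pose E : 'M[A]_5 := \matrix_i e i.
pose D : 'M[A]_5 := diag_mx (\row_i wt i).
have dotJE u i : (u *m J *m E^T *m D) 0 i = dot u (e i) * wt i.
  rewrite mul_mx_diag !mxE -dotJ !mxE; congr (_ * _).
  by apply: eq_bigr => k _; rewrite !mxE.
have EE : E *m (J *m E^T *m D) = 1%:M.
  apply/matrixP => i j; rewrite [RHS]mxE -(orth i j) -dotJE !mulmxA.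
  by rewrite -(rowK e i) -/E -!row_mul [RHS]mxE.
have vE : v = v *m J *m E^T *m D *m E.
  by rewrite -2!(mulmxA v) -(mulmxA v) (mulmx1C EE) mulmx1.
rewrite {1}vE mulmx_sum_row; apply: eq_bigr => i _.
by rewrite dotJE rowK.
Qed.

Definition e0v : vec := \row_i (i == ord0)%:R.

Lemma dot_e0v v : 0 <= eps -> dot e0v v = v 0 ord0.
Proof.
move=> eps0; rewrite dot_def ltNge eps0 /= !mxE eqxx mulr1.
rewrite big1 ?addr0 => [|i /negbTE i0]; first exact: mul1r.
by rewrite mxE i0 mul0r.
Qed.

Lemma vder_e0v i : vder i e0v = 0.
Proof.
apply/rowP => k; rewrite vder_coord !mxE; case: (k == ord0); first exact: der1.
exact: raddf0.
Qed.

End VectorFields.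

(** * The local geometry in the ring of smooth functions *)

(** [repr h a] and [vrepr V v] relate a function, or a vector field, on the plane
to the element of the ring, or the row vector over it, with the same values on
the domain. Each geometric quantity of a parametrization X has below a
counterpart over the ring, for the coordinate vector x of X. *)
Section Representation.
Variables (R : realType) (U : domain R).
Local Notation plane := 'rV[R]_2.
Local Notation A := (sfun U).
Local Notation vec := 'rV[A]_5.

Definition repr (h : plane -> R) (a : A) := forall p, U p -> h p = a p.
Definition vrepr (V : plane -> 'rV[R]_5) (v : vec) :=
  forall p, U p -> V p = evv p v.

Lemma pd_repr i h a : repr h a -> repr (pd i h) (der i a).
Proof.
move=> ha p Up; rewrite derE//.
by refine (pd_congr i (dom_open U) _ Up) => q Uq; exact: ha.
Qed.

Lemma vrepr_smooth V v : vrepr V v -> smooth_on U V.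
Proof.
move=> Vv; apply/(smooth_coordP _ (dom_open U)) => j k.
have := sfun_smooth (v 0 j) k; apply: (Ck_congr (dom_open U)) => p Up.
by rewrite Vv// mxE.
Qed.

Lemma smooth_vrepr V : smooth_on U V -> exists v, vrepr V v.
Proof.
move=> /(smooth_coordP _ (dom_open U)) sV.
exists (\row_j sval (to_sfun (sV j))) => p Up; apply/rowP => j; rewrite !mxE.
by rewrite (svalP (to_sfun (sV j))).
Qed.

Lemma pd_vrepr i V v : vrepr V v -> vrepr (pd i V) (vder i v).
Proof.
move=> Vv p Up; have sV := vrepr_smooth Vv.
apply/rowP => j; rewrite (pd_coord i j ((sV 1).1 p Up)) mxE vder_coord derE//.
by refine (pd_congr i (dom_open U) _ Up) => q Uq; rewrite Vv// mxE.
Qed.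

End Representation.

Definition xd (R : realType) (U : domain R) (x : 'rV[sfun U]_5) (i : 'I_2) :
  'rV[sfun U]_5 := vder i x.

HB.lock Definition gm (R : realType) (eps : R) (U : domain R)
  (x : 'rV[sfun U]_5) : 'M[sfun U]_2 := \matrix_(i, j) dot eps (xd x i) (xd x j).
HB.lock Definition gi (R : realType) (eps : R) (U : domain R)
  (x : 'rV[sfun U]_5) : 'M[sfun U]_2 := invmx (gm eps x).
HB.lock Definition Gam (R : realType) (eps : R) (U : domain R)
    (x : 'rV[sfun U]_5) (k i j : 'I_2) : sfun U :=
  scst U 2^-1 * \sum_l gi eps x k l *
    (der i (gm eps x j l) + der j (gm eps x i l) - der l (gm eps x i j)).
HB.lock Definition con (R : realType) (eps : R) (U : domain R)
    (x : 'rV[sfun U]_5) (i : 'I_2) (v : 'rV[sfun U]_5) : 'rV[sfun U]_5 :=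
  vder i v + (scst U eps * dot eps (xd x i) v) *: x.
HB.lock Definition Bf (R : realType) (eps : R) (U : domain R)
    (x : 'rV[sfun U]_5) (i j : 'I_2) : 'rV[sfun U]_5 :=
  con eps x i (xd x j) - \sum_k Gam eps x k i j *: xd x k.
HB.lock Definition nor (R : realType) (eps : R) (U : domain R)
    (x : 'rV[sfun U]_5) (v : 'rV[sfun U]_5) : 'rV[sfun U]_5 :=
  v - \sum_i \sum_j (gi eps x i j * dot eps v (xd x i)) *: xd x j.

Section SurfaceRepresentation.
Variables (R : realType) (eps : R) (U : domain R).
Local Notation plane := 'rV[R]_2.
Local Notation A := (sfun U).
Local Notation vec := 'rV[A]_5.
Local Notation dot := (@dot R eps U).
Local Notation "e %:S" := (scst U e) (at level 2, format "e %:S").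
Variables (X : plane -> 'rV[R]_5) (x : vec).
Local Notation xd := (xd x).
Local Notation gm := (gm eps x).
Local Notation gi := (gi eps x).
Local Notation Gam := (Gam eps x).
Local Notation con := (con eps x).
Local Notation Bf := (Bf eps x).
Local Notation nor := (nor eps x).

Definition gtr (b : 'I_2 -> 'I_2 -> vec) : vec := \sum_i \sum_j gi i j *: b i j.
Definition riem (l i j k : 'I_2) : A :=
  der i (Gam l j k) - der j (Gam l i k)
  + \sum_m (Gam l i m * Gam m j k - Gam l j m * Gam m i k).
Definition ncon i (v : vec) : vec := nor (con i v).
Definition Hv : vec := (2^-1)%:S *: gtr Bf.
Definition tau : vec := gtr Bf.

Lemma gmE i j : gm i j = dot (xd i) (xd j).
Proof. by rewrite gm.unlock mxE. Qed.

Lemma giE : gi = invmx gm. Proof. by rewrite gi.unlock. Qed.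

Lemma GamE k i j : Gam k i j = (2^-1)%:S * \sum_l gi k l *
  (der i (gm j l) + der j (gm i l) - der l (gm i j)).
Proof. by rewrite Gam.unlock. Qed.

Lemma con_def i v : con i v = vder i v + (eps%:S * dot (xd i) v) *: x.
Proof. by rewrite con.unlock. Qed.

Lemma Bf_def i j : Bf i j = con i (xd j) - \sum_k Gam k i j *: xd k.
Proof. by rewrite Bf.unlock. Qed.

Lemma norE v : nor v = v - \sum_i \sum_j (gi i j * dot v (xd i)) *: xd j.
Proof. by rewrite nor.unlock. Qed.

Hypothesis Xx : vrepr X x.
Hypothesis gm_unit : gm \in unitmx.

Lemma pdX i : vrepr (pd i X) (xd i). Proof. exact: pd_vrepr. Qed.

Lemma metric_repr i j : repr (fun p => metric eps X p i j) (gm i j).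
Proof. by move=> p Up; rewrite gmE evv_dot// mxE !pdX. Qed.

Lemma det_metric_repr p : U p -> \det (metric eps X p) = (\det gm) p.
Proof.
move=> Up; rewrite -[RHS](det_map_mx (ev Up)); congr (\det _).
by apply/matrixP => i j; rewrite (metric_repr i j Up) [RHS]mxE.
Qed.

Lemma metric_inv_repr i j : repr (fun p => metric_inv eps X p i j) (gi i j).
Proof.
move=> p Up; rewrite /metric_inv.
have -> : metric eps X p = map_mx (ev Up) gm.
  by apply/matrixP => k l; rewrite (metric_repr k l Up) [RHS]mxE.
have e : map_mx (ev Up) gm *m map_mx (ev Up) gi = 1%:M.
  by rewrite -map_mxM giE mulmxV// map_mx1.
have [gu _] := mulmx1_unit e.
rewrite -[invmx _]mulmx1 -e mulKmx//.
by rewrite [LHS]mxE.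
Qed.

Lemma christoffel_repr k i j : repr (christoffel eps X k i j) (Gam k i j).
Proof.
move=> p Up; rewrite /christoffel GamE sfunME// scstE//; congr (_ * _).
rewrite sfun_sumE//; apply: eq_bigr => l _; rewrite sfunME//.
rewrite !sfunDE// sfunNE// metric_inv_repr//.
by rewrite !(pd_repr _ (metric_repr _ _) Up).
Qed.

Lemma gtr_repr b b' p : U p ->
  (forall i j, b i j = evv p (b' i j)) -> gtrace eps X p b = evv p (gtr b').
Proof.
move=> Up bb; rewrite /gtrace /gtr evv_sum//; apply: eq_bigr => i _.
rewrite evv_sum//; apply: eq_bigr => j _.
by rewrite evvZ// metric_inv_repr// bb.
Qed.

Lemma conn_repr i V v : vrepr V v -> vrepr (conn eps X i V) (con i v).
Proof.
move=> Vv p Up; rewrite /conn con_def evvD// evvZ// sfunME// scstE// evv_dot//.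
by rewrite (pd_vrepr i Vv Up) pdX// Vv// Xx.
Qed.

Lemma sff_repr i j : vrepr (sff eps X i j) (Bf i j).
Proof.
move=> p Up; rewrite /sff Bf_def evvD// evvN// (conn_repr i (pdX j) Up).
rewrite evv_sum//; congr (_ - _); apply: eq_bigr => k _.
by rewrite evvZ// christoffel_repr// pdX.
Qed.

Lemma normal_part_repr v p : U p ->
  normal_part eps X p (evv p v) = evv p (nor v).
Proof.
move=> Up; rewrite /normal_part norE evvD// evvN// evv_sum//; congr (_ - _).
apply: eq_bigr => i _; rewrite evv_sum//; apply: eq_bigr => j _.
by rewrite evvZ// sfunME// evv_dot// metric_inv_repr// !pdX.
Qed.

Lemma nconn_repr i V v : vrepr V v -> vrepr (nconn eps X i V) (ncon i v).
Proof.
by move=> Vv p Up; rewrite /nconn (conn_repr i Vv Up) normal_part_repr.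
Qed.

Lemma mean_curv_repr : vrepr (mean_curv eps X) Hv.
Proof.
move=> p Up; rewrite /mean_curv /Hv evvZ// scstE//; congr (_ *: _).
by apply: gtr_repr => // i j; exact: sff_repr.
Qed.

Lemma tension_repr : vrepr (tension eps X) tau.
Proof. by move=> p Up; apply: gtr_repr => // i j; exact: sff_repr. Qed.

Lemma tauE : tau = 2%:R *: Hv.
Proof.
apply: evvP => p Up; rewrite evvZ// sfun_natE// /Hv evvZ// scstE// scalerA.
by rewrite mulfV ?pnatr_eq0// scale1r.
Qed.

Definition bit : vec :=
  gtr (fun i j => con i (con j tau) - \sum_k Gam k i j *: con k tau) -
  gtr (fun i j => eps%:S *: (dot tau (xd j) *: xd i - gm i j *: tau)).

Lemma bitension_repr : vrepr (bitension eps X) bit.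
Proof.
move=> p Up; rewrite /bitension /rough_laplacian opprK /bit evvD// evvN//.
congr (_ - _).
  apply: gtr_repr => // i j; rewrite evvD// evvN//; congr (_ - _).
    exact: conn_repr (conn_repr _ tension_repr) _ Up.
  rewrite evv_sum//; apply: eq_bigr => k _.
  by rewrite evvZ// christoffel_repr// (conn_repr k tension_repr Up).
apply: gtr_repr => // i j; rewrite evvZ// scstE// evvD// evvN// !evvZ//.
by rewrite /space_form_curv tension_repr// !pdX// -metric_repr// evv_dot// mxE !pdX.
Qed.

Lemma normal_curv_repr i j V v : vrepr V v ->
  vrepr (normal_curv eps X i j V) (ncon i (ncon j v) - ncon j (ncon i v)).
Proof.
move=> Vv p Up; rewrite /normal_curv evvD// evvN//.
by rewrite (nconn_repr i (nconn_repr j Vv) Up) (nconn_repr j (nconn_repr i Vv) Up).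
Qed.

Lemma riemann_repr l i j k : repr (riemann eps X l i j k) (riem l i j k).
Proof.
move=> p Up; rewrite /riemann /riem !sfunDE// sfunNE//.
rewrite !(pd_repr _ (christoffel_repr _ _ _) Up); congr (_ + _).
rewrite sfun_sumE//; apply: eq_bigr => m _.
rewrite (sfunDE Up) (sfunNE Up).
have GG a b c d e f : christoffel eps X a b c p * christoffel eps X d e f p =
    (Gam a b c * Gam d e f) p.
  rewrite (christoffel_repr a b c Up) (christoffel_repr d e f Up).
  by rewrite [RHS](sfunME Up).
by congr (_ - _); exact: GG.
Qed.

Lemma gauss_curv_repr p : U p -> gauss_curv eps X p * (\det gm) p =
  (\sum_l riem l ord0 ord_max ord_max * gm l ord0) p.
Proof.
move=> Up; rewrite /gauss_curv det_metric_repr//.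
have d0 : (\det gm) p != 0 by move/sunitP : gm_unit; apply.
rewrite divfK// sfun_sumE//; apply: eq_bigr => l _.
by rewrite sfunME// riemann_repr// metric_repr.
Qed.

End SurfaceRepresentation.

(** * Gauss formula and Gauss equation *)

Lemma ipE (R : realType) (eps : R) (u v : 'rV[R]_5)
    (i1 : 'I_5 := lift ord0 ord0) (i2 : 'I_5 := lift ord0 (lift ord0 ord0))
    (i3 : 'I_5 := lift ord0 (lift ord0 (lift ord0 ord0)))
    (i4 : 'I_5 := lift ord0 (lift ord0 (lift ord0 (lift ord0 ord0)))) :
  ip eps u v = (if eps < 0 then -1 else 1) * u 0 ord0 * v 0 ord0 +
    (u 0 i1 * v 0 i1 + u 0 i2 * v 0 i2 + u 0 i3 * v 0 i3 + u 0 i4 * v 0 i4).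
Proof.
rewrite /ip big_mkcond /= !big_ord_recl big_ord0 /= add0r addr0.
by rewrite !addrA.
Qed.

(** For eps < 0 this says that the orthogonal of a timelike vector is spacelike,
a consequence of the Cauchy-Schwarz inequality for the last four coordinates. *)
Lemma ip_tangent_gt0 (R : realType) (eps : R) (y v : 'rV[R]_5) :
  space_form eps y -> space_form_tangent eps y v -> v != 0 -> 0 < ip eps v v.
Proof.
move=> yS vT /rV0Pn[i vi0].
have sq_gt0 : 0 < v 0 ord0 ^+ 2 + \sum_(k < 5 | k != ord0) v 0 k ^+ 2.
  have <- : \sum_k v 0 k ^+ 2 = v 0 ord0 ^+ 2 + \sum_(k < 5 | k != ord0) v 0 k ^+ 2.
    by rewrite (bigD1 ord0).
  rewrite (bigD1 i)//= ltr_pwDl ?exprn_even_gt0//.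
  by apply: sumr_ge0 => k _; exact: sqr_ge0.
move: sq_gt0 yS vT; rewrite /space_form /space_form_tangent /= !ipE.
rewrite big_mkcond /= !big_ord_recl big_ord0 /= !add0r addr0.
move: (v 0 _) (v 0 _) (v 0 _) (v 0 _) (v 0 _) => v4 v3 v2 v1 v0.
case: (ltgtP eps 0) => [e0|e0|_] /=.
- move=> vv [yy /(_ isT)].
  have : eps^-1 < 0 by rewrite invr_lt0.
  move: yy; move: (y 0 _) (y 0 _) (y 0 _) (y 0 _) (y 0 _) => y4 y3 y2 y1 y0.
  move=> yy ie y0gt yv.
  have cs : (y1 * v1 + y2 * v2 + y3 * v3 + y4 * v4) ^+ 2 <=
      (y1 ^+ 2 + y2 ^+ 2 + y3 ^+ 2 + y4 ^+ 2) * (v1 ^+ 2 + v2 ^+ 2 + v3 ^+ 2 + v4 ^+ 2).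
    rewrite -subr_ge0 (_ : _ - _ = (y1 * v2 - y2 * v1) ^+ 2 +
      (y1 * v3 - y3 * v1) ^+ 2 + (y1 * v4 - y4 * v1) ^+ 2 +
      (y2 * v3 - y3 * v2) ^+ 2 + (y2 * v4 - y4 * v2) ^+ 2 +
      (y3 * v4 - y4 * v3) ^+ 2); last by ring.
    by rewrite !addr_ge0// sqr_ge0.
  have {yv} yv : y1 * v1 + y2 * v2 + y3 * v3 + y4 * v4 = y0 * v0 by lra.
  rewrite yv exprMn in cs.
  set S := v1 ^+ 2 + v2 ^+ 2 + v3 ^+ 2 + v4 ^+ 2 in cs.
  have S0 : 0 <= S by rewrite !addr_ge0// sqr_ge0.
  have y2gt0 : 0 < y0 ^+ 2 by rewrite exprn_gt0.
  have yyE : y1 ^+ 2 + y2 ^+ 2 + y3 ^+ 2 + y4 ^+ 2 = y0 ^+ 2 + eps^-1.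
    by rewrite -yy; ring.
  rewrite yyE in cs.
  have SE : v1 * v1 + v2 * v2 + v3 * v3 + v4 * v4 = S by rewrite /S; ring.
  suff : v0 ^+ 2 < S by rewrite SE; lra.
  have Sgt0 : 0 < S.
    rewrite lt_neqAle S0 andbT eq_sym; apply/eqP => S00.
    rewrite S00 mulr0 in cs; have : v0 ^+ 2 <= 0 by rewrite -(pmulr_rle0 _ y2gt0).
    by move: vv S00; rewrite /S; lra.
  rewrite -(ltr_pM2l y2gt0) (le_lt_trans cs)// mulrDl gtrDl.
  by rewrite pmulr_llt0.
- move=> vv _ _; move: vv; rewrite !expr2; lra.
- move=> vv _ _; move: vv; rewrite !expr2; lra.
Qed.

Section SurfaceGeometry.
Variables (R : realType) (eps : R) (U : domain R).
Local Notation plane := 'rV[R]_2.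
Local Notation A := (sfun U).
Local Notation vec := 'rV[A]_5.
Local Notation dot := (@dot R eps U).
Local Notation epsA := (scst U eps).
Variable x : vec.
Local Notation xd := (xd x).
Local Notation gm := (gm eps x).
Local Notation gi := (gi eps x).
Local Notation Gam := (Gam eps x).
Local Notation Bf := (Bf eps x).
Local Notation gmE := (gmE eps x).

Hypothesis x_space_form : forall p, U p -> space_form eps (evv p x).
Hypothesis x_free : forall p, U p -> forall c0 c1 : R,
  c0 *: evv p (xd ord0) + c1 *: evv p (xd ord_max) = 0 -> c0 = 0 /\ c1 = 0.

(** The normal of the space form in the ambient space: the position vector, except
for the hyperplane, whose normal is the first basis vector. The coefficient
[kap] normalizes it, see [kap_nv], and the two cases are treated together through
[kap_vder_nv] and [epsA_x]. *)
Definition nv : vec :=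
  if eps == 0 then e0v U else x.
Definition kap : A := if eps == 0 then 1 else epsA.

Lemma xd0 : eps = 0 -> forall i, xd i 0 ord0 = 0.
Proof.
move=> e0 i; rewrite /xd vder_coord.
suff -> : x 0 ord0 = 0 by exact: raddf0.
apply: sfunP => p Up; rewrite sfun0E//.
by have := x_space_form Up; rewrite /space_form /= e0 eqxx mxE.
Qed.

Lemma dot_x : eps != 0 -> epsA * dot x x = 1.
Proof.
move=> e0; apply: sfunP => p Up; rewrite sfunME// sfun1E// scstE// evv_dot//.
have := x_space_form Up; rewrite /space_form /= (negbTE e0) => -[-> _].
by rewrite mulfV.
Qed.

Lemma kap_nv : kap * dot nv nv = 1.
Proof.
rewrite /kap /nv; case: eqVneq => [e0|]; last exact: dot_x.
by rewrite mul1r dot_e0v ?e0// mxE eqxx.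
Qed.

Lemma nv_xd i : dot nv (xd i) = 0.
Proof.
rewrite /nv; case: eqVneq => [e0|e0]; first by rewrite dot_e0v ?e0// xd0.
have /(congr1 (der i)) := dot_x e0.
rewrite derM der_cst mul0r add0r der_dot der1 (dotC eps (vder i x)) => d.
have {}d : epsA * 2%:R * dot x (xd i) = 0 by rewrite -[RHS]d /xd; ring.
apply: sfunP => p Up; have := congr1 (fun a : A => a p) d.
rewrite !sfunME// sfun0E// scstE// sfun_natE// => /eqP.
by rewrite !mulf_eq0 (negbTE e0) pnatr_eq0 => /eqP.
Qed.

Lemma kap_vder_nv i : kap *: vder i nv = epsA *: xd i.
Proof.
rewrite /kap /nv; case: eqVneq => [e0|//].
rewrite vder_e0v scaler0 e0; apply: evvP => p Up.
by rewrite evvZ// evv0// scstE// scale0r.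
Qed.

Lemma epsA_x : epsA *: x = epsA *: nv.
Proof.
rewrite /nv; case: eqVneq => [e0|//].
by apply: evvP => p Up; rewrite !evvZ// scstE// e0 !scale0r.
Qed.

Lemma epsA_nv : epsA * (epsA * dot nv nv) = epsA.
Proof.
have := kap_nv; rewrite /kap; case: eqVneq => [e0 _|_ ->]; last exact: mulr1.
by apply: sfunP => p Up; rewrite sfunME// scstE// e0 mul0r.
Qed.

(** With respect to the normal [nv], the second fundamental form of the space form
in the ambient space is - eps times the metric. *)
Lemma dot_vder_nv i (v : vec) : dot v nv = 0 ->
  dot (vder i v) nv = - (epsA * dot (xd i) v * dot nv nv).
Proof.
move=> vn; have /(congr1 (der i)) := vn; rewrite der_dot raddf0 => /eqP.
rewrite addr_eq0 => /eqP ->; congr (- _); rewrite [dot v _]dotC.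
have <- : kap * dot (vder i nv) v = epsA * dot (xd i) v.
  by rewrite -!dotZl kap_vder_nv.
by rewrite mulrAC kap_nv mul1r.
Qed.

Lemma conE i (v : vec) : con eps x i v = vder i v + (epsA * dot (xd i) v) *: nv.
Proof.
by rewrite con_def; congr (_ + _); rewrite mulrC -!scalerA epsA_x.
Qed.

Lemma con_nv i (v : vec) : dot v nv = 0 -> dot (con eps x i v) nv = 0.
Proof. by move=> vn; rewrite conE dotDl dotZl dot_vder_nv// addNr. Qed.

Lemma nv_con i (v u : vec) : dot nv u = 0 -> dot (con eps x i v) u = dot (vder i v) u.
Proof. by move=> nu; rewrite conE dotDl dotZl nu mulr0 addr0. Qed.

Lemma gmC i j : gm i j = gm j i. Proof. by rewrite !gmE (dotC eps (xd i)). Qed.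

Lemma evv_nv_tangent p (v : vec) : U p -> dot nv v = 0 ->
  space_form_tangent eps (evv p x) (evv p v).
Proof.
move=> Up; rewrite /space_form_tangent /= /nv; case: eqVneq => [e0|e0] nv0.
  by rewrite mxE -(@dot_e0v _ eps) ?nv0 ?sfun0E// e0.
by rewrite -evv_dot// nv0 sfun0E.
Qed.

Lemma dot_gt0 p (v : vec) : U p -> dot nv v = 0 -> evv p v != 0 -> 0 < dot v v p.
Proof.
move=> Up nv0; rewrite evv_dot//; apply: ip_tangent_gt0 (x_space_form Up) _.
exact: evv_nv_tangent.
Qed.

Lemma gm00_gt0 : positive (gm ord0 ord0).
Proof.
move=> p Up; rewrite gmE; apply: dot_gt0 => //; first exact: nv_xd.
apply/eqP => x0; have [|/eqP] := @x_free p Up 1 0; last by rewrite oner_eq0.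
by rewrite x0 scaler0 scale0r addr0.
Qed.

Lemma det_gmE : \det gm = gm ord0 ord0 * gm ord_max ord_max - gm ord0 ord_max ^+ 2.
Proof. by rewrite det_mx2 (gmC ord_max ord0) expr2. Qed.

(** With w the second coordinate field orthogonalized against the first, the
squared norm of w is the first metric coefficient times the determinant. *)
Lemma det_gm_gt0 : positive (\det gm).
Proof.
move=> p Up.
pose w : vec := gm ord0 ord0 *: xd ord_max - gm ord0 ord_max *: xd ord0.
have g0 := gm00_gt0 Up.
have ww : dot w w = gm ord0 ord0 * \det gm.
  rewrite /w !dotE det_gmE (gmE ord0 ord_max) (gmE ord0 ord0) (gmE ord_max ord_max).
  by rewrite (dotC _ (xd ord_max) (xd ord0)); ring.
have : 0 < dot w w p.
  apply: dot_gt0 => //; first by rewrite /w !dotE !nv_xd; ring.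
  apply/eqP => w0.
  have [|_ /eqP] := @x_free p Up (- sfun_val (gm ord0 ord_max) p)
    (sfun_val (gm ord0 ord0) p); last by rewrite gt_eqF.
  by rewrite -w0 /w evvD// evvN// !evvZ// addrC scaleNr.
by rewrite ww sfunME// pmulr_rgt0.
Qed.

Lemma gm_unit : gm \in unitmx.
Proof. by rewrite unitmxE; apply/sunitP/positive_nowhere0/det_gm_gt0. Qed.

Lemma gi_gm i j : \sum_k gi i k * gm k j = (i == j)%:R.
Proof. by have /matrixP/(_ i j) := mulVmx gm_unit; rewrite -giE !mxE. Qed.

Lemma gm_gi i j : \sum_k gm i k * gi k j = (i == j)%:R.
Proof. by have /matrixP/(_ i j) := mulmxV gm_unit; rewrite -giE !mxE. Qed.

Lemma giC i j : gi i j = gi j i.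
Proof.
have gmT : gm^T = gm by apply/matrixP => k l; rewrite mxE gmC.
by rewrite giE -[in RHS]gmT -trmx_inv mxE.
Qed.

Lemma vder_xdC i j : vder i (xd j) = vder j (xd i).
Proof. exact: vder_comm. Qed.

(** The Christoffel symbols are the tangential components of the second
derivatives of the immersion. *)
Lemma Gam_gm i j l : \sum_k Gam k i j * gm k l = dot (vder i (xd j)) (xd l).
Proof.
pose K l := der i (gm j l) + der j (gm i l) - der l (gm i j).
have -> : \sum_k Gam k i j * gm k l =
    \sum_l' scst U 2^-1 * K l' * \sum_k gi l' k * gm k l.
  under eq_bigr do rewrite GamE mulr_sumr mulr_suml.
  rewrite exchange_big /=; apply: eq_bigr => l' _.
  rewrite mulr_sumr; apply: eq_bigr => k _.
  by rewrite (giC k l') /K; ring.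
rewrite (bigD1 l)//= [X in _ + X]big1 ?addr0; last first.
  by move=> l' /negbTE ll'; rewrite gi_gm ll' mulr0.
rewrite gi_gm eqxx mulr1 /K !gmE !der_dot.
rewrite -!/(xd _) (vder_xdC j i) (vder_xdC l i) (vder_xdC l j) (dotC eps (xd j)).
have := half2 U; set h := scst U 2^-1 => h2.
transitivity (h * 2%:R * dot (vder i (xd j)) (xd l)); last by rewrite h2 mul1r.
ring.
Qed.

Lemma GamC k i j : Gam k i j = Gam k j i.
Proof.
rewrite !GamE; congr (_ * _); apply: eq_bigr => l _.
by rewrite (gmC i j) [der i _ + _]addrC.
Qed.

Lemma BfC i j : Bf i j = Bf j i.
Proof.
rewrite !Bf_def !conE (vder_xdC i j) (dotC eps (xd i)); congr (_ - _).
by apply: eq_bigr => k _; rewrite GamC.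
Qed.

Lemma dot_tangent_nv (c : 'I_2 -> A) : dot (\sum_k c k *: xd k) nv = 0.
Proof. by rewrite dot_suml big1// => k _; rewrite dotZl dotC nv_xd mulr0. Qed.

Lemma Bf_nv i j : dot (Bf i j) nv = 0.
Proof.
by rewrite Bf_def dotDl dotNl dot_tangent_nv con_nv ?subr0// dotC nv_xd.
Qed.

Lemma Bf_xd i j l : dot (Bf i j) (xd l) = 0.
Proof.
rewrite Bf_def dotDl dotNl nv_con ?nv_xd// -Gam_gm dot_suml.
by apply/eqP; rewrite subr_eq0; apply/eqP/eq_bigr => k _; rewrite dotZl gmE.
Qed.

Lemma vder_xdE i j : vder i (xd j) =
  Bf i j + \sum_k Gam k i j *: xd k - (epsA * gm i j) *: nv.
Proof. by rewrite Bf_def conE -gmE subrK addrK. Qed.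

Lemma dot_Bf_vder_xd i j k l : dot (Bf i j) (vder k (xd l)) = dot (Bf i j) (Bf k l).
Proof.
rewrite vder_xdE !dotE Bf_nv mulr0 subr0 dot_sumr big1 ?addr0// => m _.
by rewrite dotZr Bf_xd mulr0.
Qed.

Lemma nv_vder_xd i j : dot nv (vder i (xd j)) = - (epsA * gm i j * dot nv nv).
Proof. by rewrite dotC dot_vder_nv ?gmE// dotC nv_xd. Qed.

(** The curvature tensor is the antisymmetrization of the left-hand side in i and
j; on the right-hand side the third derivatives are symmetric in i and j, so that
only the quadratic terms contribute. *)
Lemma Gam_gauss i j k m :
  \sum_l (der i (Gam l j k) + \sum_n Gam l i n * Gam n j k) * gm l m =
  dot (vder i (vder j (xd k))) (xd m) + dot (Bf j k) (Bf i m)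
  + epsA * gm j k * gm i m.
Proof.
pose S := \sum_l Gam l j k *: xd l.
have T1 : \sum_l der i (Gam l j k) * gm l m =
    dot (vder i (vder j (xd k))) (xd m) + dot (vder j (xd k)) (vder i (xd m))
    - \sum_l Gam l j k * dot (vder i (xd l)) (xd m) - dot S (vder i (xd m)).
  rewrite -der_dot -Gam_gm raddf_sum /= dot_suml -!sumrB; apply: eq_bigr => l _.
  by rewrite derM gmE der_dot dotZl; ring.
have T2 : \sum_l (\sum_n Gam l i n * Gam n j k) * gm l m =
    \sum_n Gam n j k * dot (vder i (xd n)) (xd m).
  under eq_bigr do rewrite mulr_suml.
  rewrite exchange_big; apply: eq_bigr => n _; rewrite -Gam_gm mulr_sumr.
  by apply: eq_bigr => l _; ring.
under eq_bigr do rewrite mulrDl.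
have T3 : dot (vder j (xd k)) (vder i (xd m)) = dot S (vder i (xd m)) +
    dot (Bf j k) (Bf i m) + epsA * (epsA * dot nv nv) * gm j k * gm i m.
  rewrite (vder_xdE j k) -/S !(dotDl, dotNl, dotZl) dot_Bf_vder_xd nv_vder_xd; ring.
by rewrite big_split /= T1 T2 T3 epsA_nv; ring.
Qed.

(** The Gauss equation of a surface in the space form. *)
Lemma riem_gm i j k m : \sum_l riem eps x l i j k * gm l m =
  dot (Bf j k) (Bf i m) - dot (Bf i k) (Bf j m)
  + epsA * (gm j k * gm i m - gm i k * gm j m).
Proof.
transitivity (\sum_l (der i (Gam l j k) + \sum_n Gam l i n * Gam n j k) * gm l m
  - \sum_l (der j (Gam l i k) + \sum_n Gam l j n * Gam n i k) * gm l m).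
  rewrite -sumrB; apply: eq_bigr => l _; rewrite /riem sumrB; ring.
rewrite !Gam_gauss (vder_comm j i); ring.
Qed.

Local Notation tau := (tau eps x).
Local Notation Hv := (Hv eps x).
Local Notation gtr := (gtr eps x).

Lemma tau_xd l : dot tau (xd l) = 0.
Proof.
rewrite dot_suml big1// => i _; rewrite dot_suml big1// => j _.
by rewrite dotZl Bf_xd mulr0.
Qed.

Lemma tau_nv : dot tau nv = 0.
Proof.
rewrite dot_suml big1// => i _; rewrite dot_suml big1// => j _.
by rewrite dotZl Bf_nv mulr0.
Qed.

Lemma trace_gm : \sum_i \sum_j gi i j * gm i j = 2%:R.
Proof.
under eq_bigr do under eq_bigr do rewrite gmC.
by under eq_bigr do rewrite gi_gm eqxx; rewrite sumr_const card_ord.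
Qed.

(** The curvature term of the bitension field is 2 eps tau, as tau is normal. *)
Lemma bitE : bit eps x =
  gtr (fun i j => con eps x i (con eps x j tau) - \sum_k Gam k i j *: con eps x k tau)
  + (epsA * 2%:R) *: tau.
Proof.
rewrite /bit; congr (_ + _); apply/eqP; rewrite eqr_oppLR; apply/eqP.
rewrite -trace_gm mulr_sumr scaler_suml -sumrN; apply: eq_bigr => i _.
rewrite mulr_sumr scaler_suml -sumrN; apply: eq_bigr => j _.
rewrite tau_xd scale0r sub0r !scalerN !scalerA; congr (- (_ *: _)); ring.
Qed.

End SurfaceGeometry.

(** * The system of equations of a biharmonic surface with K = eps *)

Section BiharmonicSystem.
Variables (R : realType) (eps : R) (U : domain R).
Local Notation plane := 'rV[R]_2.
Local Notation A := (sfun U).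

(** The derivatives along the frame fields are not coordinate derivatives; these
are the rules that they share with them. *)
Record derivation (d : A -> A) : Prop := Derivation {
  dvD : forall h k, d (h + k) = d h + d k ;
  dvM : forall h k, d (h * k) = d h * k + h * d k ;
  dvN : forall h, d (- h) = - d h ;
  dv_nat : forall n, d n%:R = 0 ;
  dv_cst : forall r, d (scst U r) = 0
}.

(** The equations satisfied, in a common eigenframe of the two shape operators,
by the mean curvature f, the shape operators diag (f + a, f - a) and
diag (b, - b), the connection coefficients al and be, and the normal connection
form (w1, w2); d1 and d2 are the derivatives along the frame. *)
Record bih_system (d1 d2 : A -> A) (f a b al be w1 w2 : A) : Prop := BihSystem {
  sys_d1 : derivation d1 ;
  sys_d2 : derivation d2 ;
  sys_comm : forall h, d1 (d2 h) - d2 (d1 h) = - al * d1 h + be * d2 h ;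
  sys_f : positive f ;
  sys_grad : forall p, U p -> d1 f p != 0 \/ d2 f p != 0 ;
  sys_abf : a ^+ 2 + b ^+ 2 = f ^+ 2 ;
  sys_d2a : d2 (f + a) = 2%:R * a * al + w2 * b ;
  sys_d1a : d1 (f - a) = - (2%:R * a * be) - w1 * b ;
  sys_d2b : d2 b = 2%:R * b * al - w2 * (f + a) ;
  sys_d1b : d1 b = 2%:R * b * be + w1 * (f - a) ;
  sys_flat : d1 w2 - d2 w1 + al * w1 - be * w2 = 0 ;
  sys_gauss : d1 be + d2 al - al ^+ 2 - be ^+ 2 = scst U eps ;
  sys_bih1 : (2%:R * f + a) * d1 f + f * b * w1 = 0 ;
  sys_bih2 : (2%:R * f - a) * d2 f - f * b * w2 = 0 ;
  sys_bih3 : d1 (d1 f) + d2 (d2 f) - al * d2 f - be * d1 f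
    - f * (w1 ^+ 2 + w2 ^+ 2) - 2%:R * f * (f ^+ 2 + a ^+ 2)
    + 2%:R * scst U eps * f = 0 ;
  sys_bih4 : 2%:R * (w1 * d1 f + w2 * d2 f)
    + f * (d1 w1 + d2 w2 - al * w2 - be * w1) - 2%:R * f * a * b = 0
}.

(** Exchanging the two frame fields changes the signs of a and b, as these are
half the differences of the two eigenvalues. *)
Lemma bih_system_swap d1 d2 f a b al be w1 w2 :
  bih_system d1 d2 f a b al be w1 w2 ->
  bih_system d2 d1 f (- a) (- b) be al w2 w1.
Proof.
case=> D1 D2 comm f0 grad abf d2a d1a d2b d1b flat gauss bih1 bih2 bih3 bih4.
split=> //.
- move=> h; have s := comm h.
  rewrite -[LHS]opprB s; ring.
- by move=> p /grad[]; [right|left].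
- by rewrite !sqrrN.
- by rewrite d1a; ring.
- by rewrite opprK d2a; ring.
- by rewrite (dvN D1) d1b; ring.
- by rewrite (dvN D2) d2b; ring.
- by rewrite -[RHS]oppr0 -flat; ring.
- by rewrite -gauss; ring.
- by rewrite -[RHS]bih2; ring.
- by rewrite -[RHS]bih1; ring.
- by rewrite -[RHS]bih3; ring.
- by rewrite -[RHS]bih4; ring.
Qed.

Section Analysis.
Variables (d1 d2 : A -> A) (f a b al be w1 w2 : A).
Hypothesis sys : bih_system d1 d2 f a b al be w1 w2.

Let D1 := sys_d1 sys.
Let D2 := sys_d2 sys.

Definition evE p (Up : U p) := (sfunDE Up, sfunNE Up, sfunME Up, sfunXE Up,
  sfun_natE Up, sfun0E Up, fun r => scstE r Up).

Lemma at_point (h k : A) p : h = k -> h p = k p. Proof. by move=> ->. Qed.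

Lemma f_gt0 p : U p -> 0 < f p. Proof. exact: (sys_f sys). Qed.

Lemma nz_f p : U p -> f p != 0. Proof. by move=> Up; rewrite gt_eqF// f_gt0. Qed.

(** In the derivative of a^2 + b^2 = f^2 the Codazzi equations give the terms
2 al (a^2 + b^2) = 2 al f^2, and the tangential biharmonic equation turns the
terms in w2 into multiples of the derivative of f. *)
Lemma d2f_al : 2%:R * f * al = 3%:R * d2 f.
Proof.
have e := congr1 d2 (sys_abf sys); rewrite !expr2 (dvD D2) !(dvM D2) (sys_d2b sys) in e.
have e2 := sys_d2a sys; rewrite (dvD D2) in e2.
have e3 := sys_bih2 sys; have e4 := sys_abf sys.
apply: sfunP => p Up; have f0 := nz_f Up.
move: (at_point p e) (at_point p e2) (at_point p e3) (at_point p e4); rewrite !(evE Up).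
move: (f p) f0 (d2 f p) (a p) (d2 a p) (b p) (w2 p) (al p) => F F0 t x y B w l.
move=> s1 s2 s3 s4; have {s2} s2 : y = 2 * x * l + w * B - t by lra.
rewrite s2 in s1; apply: (mulfI F0).
have -> : F * (2 * F * l) = 2 * l * (x ^+ 2 + B ^+ 2) by rewrite s4; ring.
lra.
Qed.

Lemma d1f_be : 2%:R * f * be = 3%:R * d1 f.
Proof.
have e := congr1 d1 (sys_abf sys); rewrite !expr2 (dvD D1) !(dvM D1) (sys_d1b sys) in e.
have e2 := sys_d1a sys; rewrite (dvD D1) (dvN D1) in e2.
have e3 := sys_bih1 sys; have e4 := sys_abf sys.
apply: sfunP => p Up; have f0 := nz_f Up.
move: (at_point p e) (at_point p e2) (at_point p e3) (at_point p e4); rewrite !(evE Up).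
move: (f p) f0 (d1 f p) (a p) (d1 a p) (b p) (w1 p) (be p) => F F0 t x y B w l.
move=> s1 s2 s3 s4; have {s2} s2 : y = 2 * x * l + w * B + t by lra.
rewrite s2 in s1; apply: (mulfI F0).
have -> : F * (2 * F * l) = 2 * l * (x ^+ 2 + B ^+ 2) by rewrite s4; ring.
lra.
Qed.

Lemma f_d1a : f * d1 a = d1 f * (2%:R * a - f).
Proof.
have e2 := sys_d1a sys; rewrite (dvD D1) (dvN D1) in e2.
have e3 := sys_bih1 sys; have e4 := d1f_be.
apply: sfunP => p Up.
move: (at_point p e2) (at_point p e3) (at_point p e4); rewrite !(evE Up).
move: (f p) (d1 f p) (a p) (d1 a p) (b p) (w1 p) (be p) => F s x x1 B w l.
move=> s2 s3 s4.
have -> : x1 = s + 2 * x * l + w * B by lra.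
have -> : F * (s + 2 * x * l + w * B) = F * s + x * (2 * F * l) + F * B * w by ring.
rewrite s4; lra.
Qed.

Lemma f_d2a : f * d2 a = d2 f * (2%:R * a + f).
Proof.
have e2 := sys_d2a sys; rewrite (dvD D2) in e2.
have e3 := sys_bih2 sys; have e4 := d2f_al.
apply: sfunP => p Up.
move: (at_point p e2) (at_point p e3) (at_point p e4); rewrite !(evE Up).
move: (f p) (d2 f p) (a p) (d2 a p) (b p) (w2 p) (al p) => F s x x1 B w l.
move=> s2 s3 s4.
have -> : x1 = 2 * x * l + w * B - s by lra.
have -> : F * (2 * x * l + w * B - s) = x * (2 * F * l) + F * B * w - F * s by ring.
rewrite s4; lra.
Qed.

(** Where b vanishes, a^2 = f^2, so that neither 2 f + a nor 2 f - a vanishes, and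
the tangential biharmonic equation makes f stationary. *)
Lemma nz_b p : U p -> b p != 0.
Proof.
move=> Up; apply/eqP => b0.
have := f_gt0 Up; have := sys_grad sys Up.
move: (at_point p (sys_abf sys)) (at_point p (sys_bih1 sys)) (at_point p (sys_bih2 sys)).
rewrite !(evE Up) b0; move: (f p) (d1 f p) (d2 f p) (a p) => F s t x.
rewrite expr0n /= addr0 !mulr0 !mul0r addr0 subr0 => /eqP.
rewrite eqf_sqr => xF /eqP s0 /eqP t0 st F0.
have n1 : 2 * F + x != 0 by case/orP : xF => /eqP ->; rewrite gt_eqF//; lra.
have n2 : 2 * F - x != 0 by case/orP : xF => /eqP ->; rewrite gt_eqF//; lra.
move: s0 t0; rewrite !mulf_eq0 (negbTE n1) (negbTE n2) /= => s0 t0.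
by case: st; rewrite ?s0 ?t0.
Qed.

(** All first derivatives of f, a, b and all connection coefficients are functions
of f, a, b, d1 f, d2 f, and the commutator of d1 and d2 on f and a determines the
mixed second derivative of f. The closedness of the normal connection form then
becomes a multiple of d1 f * d2 f. *)
Lemma d1f_d2f : d1 f * d2 f = 0.
Proof.
have e1 := congr1 d2 (sys_bih1 sys); have e2 := congr1 d1 (sys_bih2 sys).
rewrite !(dvD D2, dvM D2, dv_nat D2, sys_d2b sys) (dv_nat D2 0) in e1.
rewrite !(dvD D1, dvM D1, dvN D1, dv_nat D1, sys_d1b sys) (dv_nat D1 0) in e2.
have e3 := congr1 d2 f_d1a; have e4 := congr1 d1 f_d2a.
rewrite !(dvD D2, dvM D2, dvN D2, dv_nat D2) in e3.
rewrite !(dvD D1, dvM D1, dv_nat D1) in e4.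
apply: sfunP => p Up; have F0 := nz_f Up; have B0 := nz_b Up.
move: (at_point p e1) (at_point p e2) (at_point p e3) (at_point p e4)
  (at_point p f_d1a) (at_point p f_d2a) (at_point p d1f_be) (at_point p d2f_al)
  (at_point p (sys_bih1 sys)) (at_point p (sys_bih2 sys)) (at_point p (sys_flat sys))
  (at_point p (sys_comm sys f)) (at_point p (sys_comm sys a)) (at_point p (sys_abf sys)).
rewrite !(evE Up).
move: (f p) F0 (d1 f p) (d2 f p) (a p) (b p) B0 (al p) (be p) (w1 p) (w2 p)
  (d1 (d2 f) p) (d2 (d1 f) p) (d1 a p) (d2 a p) (d1 (d2 a) p) (d2 (d1 a) p)
  (d1 w2 p) (d2 w1 p).
clear; move=> F F0 s t x B B0 l m v w f12 f21 x1 x2 x12 x21 dw dv.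
move=> e1 e2 e3 e4 h1 h2 hm hl b1 b2 fl cf cx abf.
have {hm} hm : m = 3 * s / (2 * F) by rewrite -hm; field.
have {hl} hl : l = 3 * t / (2 * F) by rewrite -hl; field.
have {h1} h1 : x1 = s * (2 * x - F) / F by rewrite -h1; field.
have {h2} h2 : x2 = t * (2 * x + F) / F by rewrite -h2; field.
have FB0 : F * B != 0 by rewrite mulf_neq0.
have {b1} b1 : v = - (2 * F + x) * s / (F * B).
  by apply: (mulIf FB0); rewrite divfK//; lra.
have {b2} b2 : w = (2 * F - x) * t / (F * B).
  by apply: (mulIf FB0); rewrite divfK//; lra.
have f1221 : f12 = f21.
  by apply/eqP; rewrite -subr_eq0 cf hm hl; apply/eqP; field.
have {cx} cx : x12 - x21 = 3 * s * t / F.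
  by rewrite cx hm hl h1 h2; field.
(* e4 - e3 determines the mixed second derivative of f. *)
have {e3 e4} f12E : f21 = 7 * s * t / (2 * F).
  have F20 : 2 * F != 0 by rewrite mulf_neq0// pnatr_eq0.
  apply: (mulIf F20); rewrite divfK//.
  have : F * (x12 - x21) = 2 * F * f21 + t * (2 * x1 + s) - s * x2 - s * (2 * x2 - t) + t * x1.
    by rewrite f1221 in e4; lra.
  rewrite cx h1 h2.
  have -> : F * (3 * s * t / F) = 3 * s * t by field.
  have -> : 2 * F * f21 + t * (2 * (s * (2 * x - F) / F) + s) - s * (t * (2 * x + F) / F)
    - s * (2 * (t * (2 * x + F) / F) - t) + t * (s * (2 * x - F) / F) =
    2 * F * f21 - 4 * s * t by field.
  lra.
have {fl} fl : dv - dw = l * v - m * w by lra.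
have {e1 e2} S : (2 * t + x2) * s + (2 * s - x1) * t + 4 * F * f21
    + (t * B + F * (2 * B * l - w * (F + x))) * v
    - (s * B + F * (2 * B * m + v * (F - x))) * w + F * B * (l * v - m * w) = 0.
  by rewrite -fl; rewrite f1221 in e2; lra.
have {}S : s * t * (8 * F ^+ 2 - 2 * x ^+ 2 - 2 * B ^+ 2) = 0.
  rewrite -[RHS](mulr0 (B ^+ 2)) -S h1 h2 hm hl b1 b2 f12E; field.
  by rewrite B0 F0.
have F2 : 6 * F ^+ 2 != 0 by rewrite mulf_neq0 ?pnatr_eq0// expf_neq0.
by apply: (mulIf F2); rewrite mul0r -S -abf; ring.
Qed.

(** Differentiating d1 f * d2 f = 0 shows that d2 f vanishes to first order at the
point, and with it al and w2. What remains is a system of ordinary differential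
equations for f along the first frame field: the Gauss equation prescribes
d1 (d1 f), and both normal parts of the biharmonic equation have to be consistent
with it. *)
Lemma relation_at p : U p -> d1 f p != 0 ->
  eps * (2 * f p - a p) = f p * (f p - a p) ^+ 2.
Proof.
move=> Up s0.
have e1 := congr1 d1 d1f_d2f; have e2 := congr1 d2 d1f_d2f.
rewrite (dvM D1) (dv_nat D1 0) in e1; rewrite (dvM D2) (dv_nat D2 0) in e2.
have e3 := congr1 d2 d2f_al; have e4 := congr1 d1 d1f_be.
rewrite !(dvM D2, dv_nat D2) in e3; rewrite !(dvM D1, dv_nat D1) in e4.
have e5 := congr1 d1 (sys_bih1 sys); have e6 := congr1 d2 (sys_bih2 sys).
rewrite !(dvD D1, dvM D1, dv_nat D1, sys_d1b sys) (dv_nat D1 0) in e5.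
rewrite !(dvD D2, dvM D2, dvN D2, dv_nat D2) (dv_nat D2 0) in e6.
have F0 := nz_f Up; have B0 := nz_b Up.
move: (at_point p e1) (at_point p e2) (at_point p e3) (at_point p e4)
  (at_point p e5) (at_point p e6)
  (at_point p d1f_d2f) (at_point p f_d1a) (at_point p d1f_be) (at_point p d2f_al)
  (at_point p (sys_bih1 sys)) (at_point p (sys_bih2 sys))
  (at_point p (sys_bih3 sys)) (at_point p (sys_bih4 sys))
  (at_point p (sys_gauss sys)) (at_point p (sys_abf sys)).
rewrite !(evE Up).
move: (f p) F0 (d1 f p) s0 (d2 f p) (a p) (b p) B0 (al p) (be p) (w1 p) (w2 p)
  (d1 (d1 f) p) (d1 (d2 f) p) (d2 (d1 f) p) (d2 (d2 f) p) (d1 a p) (d2 a p) (d2 b p)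
  (d2 al p) (d1 be p) (d1 w1 p) (d2 w2 p).
clear; move=> F F0 s s0 t x B B0 l m v w f11 f12 f21 f22 x1 x2 B2 l2 m1 v1 w22.
move=> e1 e2 e3 e4 e5 e6 st h1 hm hl b1 b2 b3 b4 ga abf.
have FB0 : F * B != 0 by rewrite mulf_neq0.
have {st} t0 : t = 0 by apply: (mulfI s0); rewrite st mulr0.
rewrite t0 in e1 e2 e3 e4 e5 e6 h1 hm hl b1 b2 b3 b4.
have {e1} f120 : f12 = 0 by apply: (mulfI s0); lra.
have {e2} f220 : f22 = 0 by apply: (mulfI s0); lra.
have {hl} l0 : l = 0 by apply: (mulfI F0); lra.
have {b2} w0 : w = 0 by apply: (mulfI FB0); lra.
rewrite f220 l0 w0 in e3 e4 e5 e6 b3 b4 ga.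
have {e3} l20 : l2 = 0 by apply: (mulfI F0); lra.
have {e6} w220 : w22 = 0 by apply: (mulfI FB0); lra.
rewrite l20 w220 in b3 b4 ga.
have {hm} hm : m = 3 * s / (2 * F) by rewrite -hm; field.
have {h1} h1 : x1 = s * (2 * x - F) / F by rewrite -h1; field.
have {b1} b1 : v = - (2 * F + x) * s / (F * B).
  by apply: (mulIf FB0); rewrite divfK//; lra.
have u : v * B = - (2 * F + x) * s / F by rewrite b1; field; rewrite B0 F0.
have {e4 ga} f11E : f11 = 2 / 3 * eps * F + 5 / 2 * s ^+ 2 / F.
  have {}ga : m1 = eps + m ^+ 2 by lra.
  have {e4} -> : f11 = (2 * s * m + 2 * F * m1) / 3 by lra.
  by rewrite ga hm; field.
have {b4} b4 : F * v1 = 2 * F * x * B + F * m * v - 2 * v * s by lra.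
have {e5} e5 : (2 * s + x1) * s + (2 * F + x) * f11 + (3 * F * m - s) * (v * B)
    + F * (F - x) * v ^+ 2 + 2 * F * x * B ^+ 2 = 0.
  have FBv : F * B * v1 = B * (F * v1) by ring.
  by rewrite -[RHS]e5 FBv b4; ring.
have {b3} b3 : f11 - m * s - F * v ^+ 2 - 2 * F * (F ^+ 2 + x ^+ 2) + 2 * eps * F = 0.
  by rewrite -[RHS]b3; ring.
(* In e5 + (F - x) b3 the terms in v ^+ 2 cancel; once the first derivatives are
     substituted, so do the terms in s. *)
have {e5 b3} : (2 * s + x1) * s + (2 * F + x) * f11 + (3 * F * m - s) * (v * B)
    + 2 * F * x * B ^+ 2 + (F - x) * (f11 - m * s)
    + (F - x) * (2 * eps * F - 2 * F * (F ^+ 2 + x ^+ 2)) = 0.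
  rewrite -[RHS](addr0 0) -{1}e5 -(mulr0 (F - x)) -b3; ring.
have -> : B ^+ 2 = F ^+ 2 - x ^+ 2 by rewrite -abf; ring.
rewrite u h1 hm f11E => e; have F20 : 2 * F != 0 by rewrite mulf_neq0// pnatr_eq0.
by apply/(mulfI F20)/eqP; rewrite -subr_eq0 -e; apply/eqP; field.
Qed.

(** The product of d1 f and the relation of [relation_at] vanishes everywhere, so it
can be differentiated at a point where d1 f does not vanish. *)
Lemma d1f_eq0 p : U p -> d1 f p = 0.
Proof.
move=> Up; have [//|s0] := eqVneq (d1 f p) 0; exfalso.
pose E := scst U eps * (2%:R * f - a) - f * (f - a) ^+ 2.
have fE : d1 f * E = 0.
  apply: sfunP => q Uq; rewrite /E !(evE Uq).
  have [->|nz] := eqVneq (d1 f q) 0; first by rewrite mul0r.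
  by rewrite (relation_at Uq nz) subrr mulr0.
have Ep := relation_at Up s0.
have := congr1 d1 fE; rewrite (dv_nat D1 0) (dvM D1).
rewrite /E expr2 !(dvD D1, dvM D1, dvN D1, dv_nat D1, dv_cst D1) => e.
move: (at_point p e) (at_point p f_d1a) (at_point p (sys_abf sys)) (f_gt0 Up) (nz_b Up) Ep.
rewrite !(evE Up).
move: (f p) (d1 f p) s0 (a p) (b p) (d1 a p) (d1 (d1 f) p).
clear; move=> F s s0 x B x1 f11 e h1 abf F0 B0 rel.
have F0' : F != 0 by rewrite gt_eqF.
have {h1} h1 : x1 = s * (2 * x - F) / F by rewrite -h1; field.
have {e} e : eps * (2 * s - x1) - s * (F - x) ^+ 2 - 2 * F * (F - x) * (s - x1) = 0.
  apply: (mulfI s0); rewrite mulr0 -[RHS]e rel; ring.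
have {e} e : eps * (3 * F - 2 * x) = 5 * F * (F - x) ^+ 2.
  apply: (mulfI s0); apply/eqP; rewrite -subr_eq0; apply/eqP.
  by rewrite -[RHS](mulr0 F) -e h1; field.
have B2 : 0 < (F - x) * (F + x).
  by rewrite (_ : _ * _ = B ^+ 2) ?exprn_even_gt0// -[RHS](addKr (x ^+ 2)) abf; ring.
have y0 : F - x != 0 by apply: contraTneq B2 => ->; rewrite mul0r ltxx.
have xF : 7 * F = 3 * x.
  have n : F * (F - x) ^+ 2 != 0 by rewrite mulf_neq0// expf_neq0.
  apply: (mulIf n).
  have : (3 * F - 2 * x) * (eps * (2 * F - x)) = (2 * F - x) * (eps * (3 * F - 2 * x)) by ring.
  rewrite rel e; lra.
have xE : x = 7 / 3 * F by lra.
move: B2; rewrite xE (_ : _ * _ = - (40 / 9 * F ^+ 2)); last by field.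
have := exprn_gt0 2 F0; lra.
Qed.

End Analysis.

Lemma bih_system_false d1 d2 f a b al be w1 w2 :
  ~ bih_system d1 d2 f a b al be w1 w2.
Proof.
move=> sys; have Up := dom_ptP U.
case: (sys_grad sys Up); first by rewrite (d1f_eq0 sys Up) eqxx.
by rewrite (d1f_eq0 (bih_system_swap sys) Up) eqxx.
Qed.

End BiharmonicSystem.

(** * Moving frames *)

(** The frame fields e1, e2 are the combinations of the coordinate fields with
coefficients in the rows of c; [pa a] and [va a] differentiate functions and
vector fields along the frame field with index a. The normal frame is e3, e4. *)
Section MovingFrame.
Variables (R : realType) (eps : R) (U : domain R).
Local Notation plane := 'rV[R]_2.
Local Notation A := (sfun U).
Local Notation vec := 'rV[A]_5.
Local Notation dot := (@dot R eps U).
Local Notation epsA := (scst U eps).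
Variable x : vec.
Local Notation xd := (xd x).
Local Notation gm := (gm eps x).
Local Notation gi := (gi eps x).
Local Notation Gam := (Gam eps x).
Local Notation Bf := (Bf eps x).
Local Notation gmE := (gmE eps x).
Local Notation con := (con eps x).
Local Notation tau := (tau eps x).
Local Notation nv := (nv eps x).
Local Notation kap := (kap eps U).

Hypothesis x_space_form : forall p, U p -> space_form eps (evv p x).
Hypothesis x_free : forall p, U p -> forall c0 c1 : R,
  c0 *: evv p (xd ord0) + c1 *: evv p (xd ord_max) = 0 -> c0 = 0 /\ c1 = 0.

Let nv_xd := nv_xd x_space_form.

Variable c : 'M[A]_2.
Definition fr (a : 'I_2) : vec := \sum_i c a i *: xd i.
Definition pa (a : 'I_2) (h : A) : A := \sum_i c a i * der i h.
Definition va (a : 'I_2) (v : vec) : vec := \sum_i c a i *: vder i v.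

Lemma paD a h k : pa a (h + k) = pa a h + pa a k.
Proof. by rewrite -big_split; apply: eq_bigr => i _ /=; rewrite derD mulrDr. Qed.
Lemma pa_sum a I r (P : pred I) (F : I -> A) :
  pa a (\sum_(j <- r | P j) F j) = \sum_(j <- r | P j) pa a (F j).
Proof.
rewrite /pa exchange_big; apply: eq_bigr => i _ /=.
by rewrite (raddf_sum (der i)) mulr_sumr.
Qed.
Lemma paM a h k : pa a (h * k) = pa a h * k + h * pa a k.
Proof.
rewrite mulr_suml mulr_sumr -big_split; apply: eq_bigr => i _ /=; rewrite derM; ring.
Qed.
Lemma pa_cst a r : pa a (scst U r) = 0.
Proof. by rewrite /pa big1// => i _; rewrite der_cst mulr0. Qed.
Lemma paN a h : pa a (- h) = - pa a h.
Proof. by rewrite -sumrN; apply: eq_bigr => i _; rewrite raddfN mulrN. Qed.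
Lemma vaZ a h v : va a (h *: v) = pa a h *: v + h *: va a v.
Proof.
rewrite scaler_suml scaler_sumr -big_split; apply: eq_bigr => i _ /=.
by rewrite vderZ scalerDr !scalerA (mulrC h).
Qed.
Lemma pa_dot a u v : pa a (dot u v) = dot (va a u) v + dot u (va a v).
Proof.
rewrite dot_suml dot_sumr -big_split; apply: eq_bigr => i _ /=.
by rewrite der_dot mulrDr dotZl dotZr.
Qed.
Lemma va_coord a v k : va a v 0 k = pa a (v 0 k).
Proof. by rewrite summxE; apply: eq_bigr => i _; rewrite mxE vder_coord. Qed.
Lemma va_sum a I r (P : pred I) (F : I -> vec) :
  va a (\sum_(j <- r | P j) F j) = \sum_(j <- r | P j) va a (F j).
Proof.
rewrite /va exchange_big; apply: eq_bigr => i _ /=.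
by rewrite vder_sum scaler_sumr.
Qed.

Lemma dot_fr a v : dot v (fr a) = \sum_i c a i * dot v (xd i).
Proof. by rewrite dot_sumr; apply: eq_bigr => i _; rewrite dotZr. Qed.

Lemma tangent_inj (q : 'I_2 -> A) : \sum_i q i *: xd i = 0 -> forall i, q i = 0.
Proof.
move=> q0; have Q : (\row_i q i) *m gm = 0.
  apply/rowP => l; rewrite mxE [RHS]mxE -[RHS](dot0l eps (xd l)) -q0 dot_suml.
  by apply: eq_bigr => i _; rewrite mxE gmE dotZl.
have /rowP Q0 : \row_i q i = 0.
  by rewrite -[LHS](mulmxK (gm_unit x_space_form x_free)) Q mul0mx.
by move=> i; have := Q0 i; rewrite !mxE.
Qed.

Hypothesis fr_orth : forall a b, dot (fr a) (fr b) = (a == b)%:R.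
Variables e3 e4 : vec.
Hypotheses (e33 : dot e3 e3 = 1) (e44 : dot e4 e4 = 1) (e34 : dot e3 e4 = 0).
Hypotheses (e3_xd : forall i, dot e3 (xd i) = 0) (e4_xd : forall i, dot e4 (xd i) = 0).
Hypotheses (e3_nv : dot e3 nv = 0) (e4_nv : dot e4 nv = 0).

Local Notation e1 := (fr ord0).
Local Notation e2 := (fr ord_max).

Lemma fr_nv a : dot (fr a) nv = 0.
Proof. exact: dot_tangent_nv. Qed.

Lemma fr_normal a v : (forall i, dot v (xd i) = 0) -> dot (fr a) v = 0.
Proof. by move=> v0; rewrite dotC dot_fr big1// => i _; rewrite v0 mulr0. Qed.

Lemma e11 : dot e1 e1 = 1. Proof. exact: fr_orth. Qed.
Lemma e22 : dot e2 e2 = 1. Proof. exact: fr_orth. Qed.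
Lemma e12 : dot e1 e2 = 0. Proof. exact: fr_orth. Qed.
Lemma e13 : dot e1 e3 = 0. Proof. exact: fr_normal. Qed.
Lemma e14 : dot e1 e4 = 0. Proof. exact: fr_normal. Qed.
Lemma e23 : dot e2 e3 = 0. Proof. exact: fr_normal. Qed.
Lemma e24 : dot e2 e4 = 0. Proof. exact: fr_normal. Qed.
Lemma e21 : dot e2 e1 = 0. Proof. exact: fr_orth. Qed.
Lemma e31 : dot e3 e1 = 0. Proof. by rewrite dotC e13. Qed.
Lemma e32 : dot e3 e2 = 0. Proof. by rewrite dotC e23. Qed.
Lemma e41 : dot e4 e1 = 0. Proof. by rewrite dotC e14. Qed.
Lemma e42 : dot e4 e2 = 0. Proof. by rewrite dotC e24. Qed.
Lemma e43 : dot e4 e3 = 0. Proof. by rewrite dotC e34. Qed.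
Lemma nv_fr a : dot nv (fr a) = 0. Proof. by rewrite dotC fr_nv. Qed.
Lemma nv_e3 : dot nv e3 = 0. Proof. by rewrite dotC e3_nv. Qed.
Lemma nv_e4 : dot nv e4 = 0. Proof. by rewrite dotC e4_nv. Qed.

Definition gram := (e11, e22, e33, e44, e12, e13, e14, e23, e24, e34, e21, e31, e32, e41, e42, e43,
  fr_nv, nv_fr, e3_nv, e4_nv, nv_e3, nv_e4).

Lemma expansion v : v = dot v e1 *: e1 + dot v e2 *: e2 + dot v e3 *: e3 +
  dot v e4 *: e4 + (kap * dot v nv) *: nv.
Proof.
pose e (i : 'I_5) := nth 0 [:: e1; e2; e3; e4; nv] i.
pose wt (i : 'I_5) : A := nth 0 [:: 1; 1; 1; 1; kap] i.
have orth (i j : 'I_5) : dot (e i) (e j) * wt j = (i == j)%:R.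
  case: i => [[|[|[|[|[|//]]]]] ?]; case: j => [[|[|[|[|[|//]]]]] ?];
  by rewrite /e /wt /= ?gram ?mul0r ?mul1r// mulrC kap_nv.
rewrite {1}[v](orthogonal_expansion orth) !big_ord_recl big_ord0 addr0.
by rewrite /e /wt /= !mulr1 (mulrC _ kap) !addrA.
Qed.

Lemma tangent_expansion (q : 'I_2 -> A) (v := \sum_i q i *: xd i) :
  v = dot v e1 *: e1 + dot v e2 *: e2.
Proof.
have nz w : (forall i, dot w (xd i) = 0) -> dot v w = 0.
  by move=> w0; rewrite dot_suml big1// => i _; rewrite dotZl dotC w0 mulr0.
rewrite {1}[v]expansion (nz e3)// (nz e4)// (nz nv); last exact: nv_xd.
by rewrite mulr0 !scale0r !addr0.
Qed.

Lemma tangent_coord (q : 'I_2 -> A) r s : (\sum_i q i *: xd i : vec) = r *: e1 + s *: e2 ->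
  forall i, q i = r * c ord0 i + s * c ord_max i.
Proof.
move=> qrs i; apply/eqP; rewrite -subr_eq0; apply/eqP.
apply: (tangent_inj (q := fun i => q i - (r * c ord0 i + s * c ord_max i))).
under eq_bigr do rewrite scalerBl scalerDl -!scalerA.
by rewrite sumrB big_split /= -!scaler_sumr qrs subrr.
Qed.

(** The connection coefficients of the frame: the tangential parts of the
derivatives of e1 along e1 and of e2 along e2 are al e2 and be e1. *)
Definition al : A := dot (va ord0 e1) e2.
Definition be : A := dot (va ord_max e2) e1.

Lemma va_norm a v : dot v v = 1 -> dot (va a v) v = 0.
Proof.
move=> /(congr1 (pa a)); rewrite pa_dot (dotC eps v) -[X in pa a X]/1 => d.
have {}d : 2%:R * dot (va a v) v = 0.
  rewrite -[RHS](pa_cst a 1) -[LHS]/(2%:R * _) mulr_natl mulr2n d.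
  by congr (pa a _); apply: sfunP => p Up; rewrite sfun1E// scstE.
exact: two_inj.
Qed.

Lemma va_swap a u v : dot u v = 0 -> dot (va a u) v = - dot (va a v) u.
Proof.
move=> /(congr1 (pa a)); rewrite pa_dot (dotC eps u) => d; apply/eqP.
rewrite -addr_eq0 d /pa big1// => i _; rewrite raddf0 mulr0//.
Qed.

(** Coordinates of the Lie bracket of the frame fields, see [brk_pa]. *)
Definition brk i : A := pa ord0 (c ord_max i) - pa ord_max (c ord0 i).

Lemma brk_pa h : pa ord0 (pa ord_max h) - pa ord_max (pa ord0 h) =
  \sum_i brk i * der i h.
Proof.
have E a b : pa a (pa b h) =
    \sum_i pa a (c b i) * der i h + \sum_i \sum_j c a j * c b i * der j (der i h).
  rewrite -big_split {2}/pa pa_sum; apply: eq_bigr => i _ /=.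
  rewrite paM /pa mulr_sumr; congr (_ + _).
  by apply: eq_bigr => j _; rewrite mulrCA mulrA.
rewrite !E opprD addrACA -sumrB.
rewrite [X in _ + (X - _)]exchange_big /=.
have -> : \sum_j \sum_i c ord0 j * c ord_max i * der j (der i h) =
    \sum_i \sum_j c ord_max j * c ord0 i * der j (der i h).
  apply: eq_bigr => i _; apply: eq_bigr => j _; rewrite der_comm; ring.
by rewrite subrr addr0; apply: eq_bigr => i _; rewrite /brk mulrBl.
Qed.

Lemma brk_va v : va ord0 (va ord_max v) - va ord_max (va ord0 v) =
  \sum_i brk i *: vder i v.
Proof.
apply/rowP => k; rewrite mxE [X in _ + X]mxE !va_coord brk_pa summxE.
by apply: eq_bigr => i _; rewrite mxE vder_coord.
Qed.

Lemma va_x a : va a x = fr a. Proof. by []. Qed.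

Lemma brkE i : brk i = - al * c ord0 i + be * c ord_max i.
Proof.
apply: (tangent_coord (r := - al) (s := be)).
rewrite [LHS]tangent_expansion; congr (_ *: _ + _ *: _).
  rewrite -brk_va !va_x dotDl dotNl (va_norm _ e11) subr0.
  by rewrite va_swap// e21.
rewrite -brk_va !va_x dotDl dotNl (va_norm _ e22) sub0r.
by rewrite va_swap ?e12// opprK.
Qed.

Lemma pa_comm h : pa ord0 (pa ord_max h) - pa ord_max (pa ord0 h) =
  - al * pa ord0 h + be * pa ord_max h.
Proof.
rewrite brk_pa !mulr_sumr -big_split; apply: eq_bigr => i _ /=; rewrite brkE /=; ring.
Qed.

Lemma va_comm v : va ord0 (va ord_max v) - va ord_max (va ord0 v) =
  (- al) *: va ord0 v + be *: va ord_max v.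
Proof.
by apply/rowP => k; rewrite !(mxE, va_coord) pa_comm.
Qed.

(** The ambient space is flat, so the commutator of two derivatives of Y is the
derivative along the bracket of the frame fields. For Y and Z among the frame
vectors, this yields the Ricci, Codazzi and Gauss equations. *)
Lemma structure_eq Y Z :
  pa ord0 (dot (va ord_max Y) Z) - pa ord_max (dot (va ord0 Y) Z)
  + al * dot (va ord0 Y) Z - be * dot (va ord_max Y) Z =
  dot (va ord_max Y) (va ord0 Z) - dot (va ord0 Y) (va ord_max Z).
Proof.
rewrite !pa_dot.
have : dot (va ord0 (va ord_max Y) - va ord_max (va ord0 Y)) Z =
  dot ((- al) *: va ord0 Y + be *: va ord_max Y) Z by rewrite va_comm.
rewrite !(dotDl, dotNl, dotZl) => /eqP; rewrite subr_eq => /eqP ->; ring.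
Qed.

Lemma va_nv a u : dot u nv = 0 -> kap * dot (va a u) nv = - (epsA * dot (fr a) u).
Proof.
move=> u0; rewrite dot_suml dot_suml !mulr_sumr -sumrN; apply: eq_bigr => i _.
rewrite !dotZl (dot_vder_nv x_space_form)//.
rewrite -[X in _ = - (epsA * (c a i * X))]mulr1 -(kap_nv x_space_form); ring.
Qed.

Lemma va_fr a b v : (forall i, dot v (xd i) = 0) -> dot v nv = 0 ->
  dot (va a (fr b)) v = \sum_i \sum_j c a i * c b j * dot (Bf i j) v.
Proof.
move=> v0 vn; rewrite dot_suml; apply: eq_bigr => i _.
rewrite dotZl vder_sum dot_suml mulr_sumr; apply: eq_bigr => j _.
rewrite vderZ dotDl !dotZl [dot (xd j) v]dotC v0 mulr0 add0r mulrA; congr (_ * _).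
rewrite (vder_xdE eps) !dotDl dotNl dotZl (dotC eps nv) vn mulr0 subr0 dot_suml.
by rewrite big1 ?addr0// => k _; rewrite dotZl dotC v0 mulr0.
Qed.

Lemma va_frC a b v : (forall i, dot v (xd i) = 0) -> dot v nv = 0 ->
  dot (va a (fr b)) v = dot (va b (fr a)) v.
Proof.
move=> v0 vn; rewrite !va_fr// exchange_big; apply: eq_bigr => i _.
by apply: eq_bigr => j _ /=; rewrite (BfC eps x i j) (mulrC (c a _)).
Qed.

(** Orthonormality of the frame says that c g c^T = 1, hence c^T c is the inverse
of g. *)
Lemma gi_fr i j : gi i j = \sum_a c a i * c a j.
Proof.
have cgc : c *m gm *m c^T = 1%:M.
  apply/matrixP => a b; rewrite [RHS]mxE -fr_orth dot_fr mxE.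
  apply: eq_bigr => k _; rewrite mxE [c^T _ _]mxE mulrC; congr (_ * _).
  by rewrite dotC dot_fr; apply: eq_bigr => l _; rewrite gmE dotC.
have ccg : c^T *m c *m gm = 1%:M by rewrite -mulmxA; exact: mulmx1C.
have -> : gi = c^T *m c.
  by rewrite giE -[LHS]mul1mx -ccg mulmxK// (gm_unit x_space_form x_free).
by rewrite mxE; apply: eq_bigr => a _; rewrite mxE.
Qed.

Lemma trace_fr v : (forall i, dot v (xd i) = 0) -> dot v nv = 0 ->
  dot (va ord0 e1) v + dot (va ord_max e2) v = dot tau v.
Proof.
move=> v0 vn; transitivity (\sum_a dot (va a (fr a)) v).
  by rewrite sumI2.
rewrite (eq_bigr _ (fun a _ => va_fr a a v0 vn)) exchange_big dot_suml.
apply: eq_bigr => i _ /=; rewrite exchange_big dot_suml; apply: eq_bigr => j _ /=.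
by rewrite dotZl gi_fr mulr_suml.
Qed.

Variable f : A.
Hypothesis tau_e3 : tau = (2%:R * f) *: e3.
Hypothesis eigen : dot (va ord0 e2) e3 = 0.

(** A_3 = diag (f + aa, f - aa); the entries of A_4 are bb, dd and - bb, and the
normal connection form is (w1, w2). *)
Definition aa : A := dot (va ord0 e1) e3 - f.
Definition bb : A := dot (va ord0 e1) e4.
Definition dd : A := dot (va ord0 e2) e4.
Definition w1 : A := dot (va ord0 e3) e4.
Definition w2 : A := dot (va ord_max e3) e4.

Lemma h3_11 : dot (va ord0 e1) e3 = f + aa. Proof. by rewrite /aa addrC subrK. Qed.
Lemma h3_21 : dot (va ord_max e1) e3 = 0. Proof. by rewrite va_frC. Qed.
Lemma h3_22 : dot (va ord_max e2) e3 = f - aa.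
Proof.
have := trace_fr e3_xd e3_nv; rewrite tau_e3 dotZl e33 h3_11 => t.
apply: (addrI (f + aa)); rewrite t; ring.
Qed.
Lemma h4_21 : dot (va ord_max e1) e4 = dd. Proof. by rewrite va_frC. Qed.
Lemma h4_22 : dot (va ord_max e2) e4 = - bb.
Proof.
have := trace_fr e4_xd e4_nv; rewrite tau_e3 dotZl e34 mulr0 => /eqP.
by rewrite addrC addr_eq0 => /eqP.
Qed.

Lemma V1e1 : va ord0 e1 = al *: e2 + (f + aa) *: e3 + bb *: e4 - epsA *: nv.
Proof.
rewrite [LHS]expansion (va_norm _ e11) h3_11 va_nv ?fr_nv// e11 mulr1.
by rewrite scale0r add0r scaleNr.
Qed.
Lemma V1e2 : va ord0 e2 = (- al) *: e1 + dd *: e4.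
Proof.
rewrite [LHS]expansion (va_norm _ e22) (va_swap _ e21) eigen va_nv ?fr_nv// e12.
by rewrite mulr0 oppr0 !scale0r !addr0.
Qed.
Lemma V2e1 : va ord_max e1 = (- be) *: e2 + dd *: e4.
Proof.
rewrite [LHS]expansion (va_norm _ e11) (va_swap _ e12) h3_21 h4_21 va_nv ?fr_nv// e21.
by rewrite mulr0 oppr0 !scale0r !addr0 add0r.
Qed.
Lemma V2e2 : va ord_max e2 = be *: e1 + (f - aa) *: e3 - bb *: e4 - epsA *: nv.
Proof.
rewrite [LHS]expansion (va_norm _ e22) h3_22 h4_22 va_nv ?fr_nv// e22 mulr1.
by rewrite scale0r addr0 !scaleNr.
Qed.
Lemma V1e3 : va ord0 e3 = - (f + aa) *: e1 + w1 *: e4.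
Proof.
rewrite [LHS]expansion (va_norm _ e33) (va_swap _ e31) (va_swap _ e32) h3_11 eigen.
by rewrite va_nv// e13 mulr0 !oppr0 !scale0r !addr0.
Qed.
Lemma V2e3 : va ord_max e3 = - (f - aa) *: e2 + w2 *: e4.
Proof.
rewrite [LHS]expansion (va_norm _ e33) (va_swap _ e31) (va_swap _ e32) h3_21 h3_22.
by rewrite va_nv// e23 mulr0 !oppr0 !scale0r !addr0 add0r.
Qed.
Lemma V1e4 : va ord0 e4 = (- bb) *: e1 - dd *: e2 - w1 *: e3.
Proof.
rewrite [LHS]expansion (va_norm _ e44) (va_swap _ e41) (va_swap _ e42) (va_swap _ e43).
by rewrite va_nv// e14 mulr0 oppr0 !scale0r !addr0 !scaleNr.
Qed.
Lemma V2e4 : va ord_max e4 = (- dd) *: e1 + bb *: e2 - w2 *: e3.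
Proof.
rewrite [LHS]expansion (va_norm _ e44) (va_swap _ e41) (va_swap _ e42) (va_swap _ e43).
rewrite h4_21 h4_22 opprK.
by rewrite va_nv// e24 mulr0 oppr0 !scale0r !addr0 !scaleNr.
Qed.

Definition frame_der := (V1e1, V1e2, V2e1, V2e2, V1e3, V2e3, V1e4, V2e4).
Lemma pa0 a : pa a 0 = 0.
Proof. by rewrite /pa big1// => i _; rewrite raddf0 mulr0. Qed.

Definition expand := (dotE, gram, mulr0, mulr1, mul0r, mul1r, addr0, add0r, oppr0, subr0, sub0r, pa0).

Lemma ricci : pa ord0 w2 - pa ord_max w1 + al * w1 - be * w2 = - (2%:R * aa * dd).
Proof.
by have := structure_eq e3 e4; rewrite !frame_der !expand => ->; ring.
Qed.

Lemma paB a h k : pa a (h - k) = pa a h - pa a k.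
Proof. by rewrite paD paN. Qed.

Section Codazzi.
Hypothesis dd0 : dd = 0.

Lemma codazzi3_2 : pa ord_max (f + aa) = 2%:R * aa * al + w2 * bb.
Proof.
have := structure_eq e1 e3; rewrite !frame_der dd0 !expand => s.
by apply: eq_of_subN s _; ring.
Qed.

Lemma codazzi3_1 : pa ord0 (f - aa) = - (2%:R * aa * be) - w1 * bb.
Proof.
have := structure_eq e2 e3; rewrite !frame_der dd0 !expand => s.
by apply: eq_of_sub s _; ring.
Qed.

Lemma codazzi4_2 : pa ord_max bb = 2%:R * bb * al - w2 * (f + aa).
Proof.
have := structure_eq e1 e4; rewrite !frame_der dd0 !expand => s.
by apply: eq_of_subN s _; ring.
Qed.

Lemma codazzi4_1 : pa ord0 bb = 2%:R * bb * be + w1 * (f - aa).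
Proof.
have := structure_eq e2 e4; rewrite !frame_der dd0 !expand paN => s.
by apply: eq_of_subN s _; ring.
Qed.

Lemma gauss : pa ord0 be + pa ord_max al - al ^+ 2 - be ^+ 2 =
  epsA + f ^+ 2 - aa ^+ 2 - bb ^+ 2.
Proof.
have := structure_eq e1 e2; rewrite !frame_der dd0 !expand paN => s.
have e := epsA_nv x_space_form.
apply: (eq_of_subN (congr2 (fun y z => y - z) s e)); ring.
Qed.

End Codazzi.

Lemma conD i u v : con i (u + v) = con i u + con i v.
Proof. by rewrite !con_def vderD dotDr mulrDr scalerDl addrACA. Qed.

Lemma conZ i a v : con i (a *: v) = der i a *: v + a *: con i v.
Proof. by rewrite !con_def vderZ dotZr mulrCA scalerDr scalerA addrA. Qed.

(** The derivative along the frame followed by projection onto the tangent spaces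
of the space form. *)
Definition cva (a : 'I_2) (v : vec) : vec := \sum_i c a i *: con i v.

Lemma cvaE a v : cva a v = va a v + (epsA * dot (fr a) v) *: nv.
Proof.
rewrite dot_suml mulr_sumr scaler_suml -big_split; apply: eq_bigr => i _ /=.
by rewrite conE scalerDr scalerA dotZl mulrCA.
Qed.

(** Coordinates of the sum of the covariant derivatives of each frame field along
itself, the first-order term of the Laplacian in the frame. *)
Lemma frame_divergence j : \sum_a pa a (c a j) + \sum_i \sum_k gi i k * Gam j i k =
  be * c ord0 j + al * c ord_max j.
Proof.
pose q j := \sum_a pa a (c a j) + \sum_i \sum_k gi i k * Gam j i k.
apply: (tangent_coord (q := q)); rewrite [LHS]tangent_expansion.
have qdot l : dot (\sum_j q j *: xd j) (xd l) = \sum_a dot (va a (fr a)) (xd l).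
  transitivity (\sum_a \sum_j pa a (c a j) * gm j l +
      \sum_i \sum_k gi i k * dot (vder i (xd k)) (xd l)).
    rewrite dot_suml exchange_big /=.
    have -> : \sum_i \sum_k gi i k * dot (vder i (xd k)) (xd l) =
        \sum_j \sum_i \sum_k gi i k * Gam j i k * gm j l.
      rewrite [RHS]exchange_big; apply: eq_bigr => i _ /=.
      rewrite [RHS]exchange_big; apply: eq_bigr => k _ /=.
      by rewrite -(Gam_gm x_space_form x_free) mulr_sumr; apply: eq_bigr => m _; rewrite mulrA.
    rewrite -big_split; apply: eq_bigr => m _ /=.
    rewrite dotZl -gmE mulrDl mulr_suml; congr (_ + _).
    by rewrite mulr_suml; apply: eq_bigr => i _; rewrite mulr_suml.
  have -> : \sum_i \sum_k gi i k * dot (vder i (xd k)) (xd l) =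
      \sum_a \sum_k c a k * dot (va a (xd k)) (xd l).
    rewrite [LHS]exchange_big [RHS]exchange_big; apply: eq_bigr => k _ /=.
    under [RHS]eq_bigr do rewrite /va dot_suml mulr_sumr.
    rewrite [RHS]exchange_big; apply: eq_bigr => i _ /=.
    rewrite gi_fr mulr_suml; apply: eq_bigr => a _.
    rewrite dotZl; ring.
  rewrite -big_split; apply: eq_bigr => a _ /=.
  rewrite va_sum dot_suml -big_split; apply: eq_bigr => m _ /=.
  by rewrite vaZ dotDl !dotZl gmE.
have qfr b : dot (\sum_j q j *: xd j) (fr b) = \sum_a dot (va a (fr a)) (fr b).
  rewrite dot_fr; under eq_bigr do rewrite qdot mulr_sumr.
  by rewrite exchange_big; apply: eq_bigr => a _; rewrite dot_fr.
by rewrite !qfr !sumI2 (va_norm _ e11) (va_norm _ e22) add0r addr0.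
Qed.

Lemma con_sum i I r (P : pred I) (F : I -> vec) :
  con i (\sum_(j <- r | P j) F j) = \sum_(j <- r | P j) con i (F j).
Proof.
elim/big_rec2: _ => [|j u v _ <-]; last by rewrite conD.
by rewrite -[X in con i X](scale0r 0) conZ raddf0 !scale0r addr0.
Qed.

Lemma cva_cva v : \sum_a cva a (cva a v) =
  \sum_i \sum_k gi i k *: con i (con k v) + \sum_j (\sum_a pa a (c a j)) *: con j v.
Proof.
have -> : \sum_j (\sum_a pa a (c a j)) *: con j v =
    \sum_a \sum_i \sum_j (c a i * der i (c a j)) *: con j v.
  under eq_bigr do rewrite scaler_suml.
  rewrite exchange_big; apply: eq_bigr => a _; rewrite [RHS]exchange_big.
  by apply: eq_bigr => j _; rewrite /pa scaler_suml.
have -> : \sum_i \sum_k gi i k *: con i (con k v) =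
    \sum_a \sum_i \sum_k (c a i * c a k) *: con i (con k v).
  rewrite [RHS]exchange_big; apply: eq_bigr => i _ /=.
  rewrite [RHS]exchange_big; apply: eq_bigr => k _ /=.
  by rewrite gi_fr scaler_suml.
rewrite -big_split; apply: eq_bigr => a _; rewrite -big_split; apply: eq_bigr => i _ /=.
rewrite con_sum scaler_sumr -big_split; apply: eq_bigr => k _ /=.
by rewrite conZ scalerDr !scalerA addrC.
Qed.

(** The bitension field in the moving frame, up to its component along the
normal of the space form. *)
Lemma bit_frame Z : dot nv Z = 0 -> bit eps x = 0 ->
  dot (va ord0 (va ord0 tau) + va ord_max (va ord_max tau)
    - al *: va ord_max tau - be *: va ord0 tau + (epsA * 2%:R) *: tau) Z = 0.
Proof.
move=> nZ; rewrite (bitE x_space_form x_free) => b0.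
have fr_tau a : dot (fr a) tau = 0 by apply: fr_normal; exact: (tau_xd x_space_form x_free).
have cva_tau a : cva a tau = va a tau by rewrite cvaE fr_tau mulr0 scale0r addr0.
have dotcva a w : dot (cva a w) Z = dot (va a w) Z by rewrite cvaE dotDl dotZl nZ mulr0 addr0.
have {}b0 : cva ord0 (cva ord0 tau) + cva ord_max (cva ord_max tau)
    - al *: cva ord_max tau - be *: cva ord0 tau + (epsA * 2%:R) *: tau = 0.
  rewrite -[RHS]b0; congr (_ + _).
  pose C := \sum_i \sum_k gi i k *: \sum_j Gam j i k *: con j tau.
  pose B := \sum_j (\sum_a pa a (c a j)) *: con j tau.
  have gtrE : gtr eps x (fun i j => con i (con j tau) - \sum_k Gam k i j *: con k tau) =
      \sum_i \sum_k gi i k *: con i (con k tau) - C.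
    rewrite /gtr /C -sumrB; apply: eq_bigr => i _; rewrite -sumrB.
    by apply: eq_bigr => j _; rewrite scalerBr.
  have BC : B + C = be *: cva ord0 tau + al *: cva ord_max tau.
    have -> : C = \sum_j (\sum_i \sum_k gi i k * Gam j i k) *: con j tau.
      under [RHS]eq_bigr do rewrite scaler_suml.
      rewrite [RHS]exchange_big; apply: eq_bigr => i _ /=.
      under [RHS]eq_bigr do rewrite scaler_suml.
      rewrite [RHS]exchange_big; apply: eq_bigr => k _ /=.
      by rewrite scaler_sumr; apply: eq_bigr => j _; rewrite scalerA.
    rewrite /cva !scaler_sumr -!big_split; apply: eq_bigr => j _ /=.
    by rewrite -scalerDl frame_divergence scalerDl !scalerA.
  rewrite gtrE -(sumI2 (fun a => cva a (cva a tau))) cva_cva -/B.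
  have -> : B = be *: cva ord0 tau + al *: cva ord_max tau - C by rewrite -BC addrK.
  set p := be *: _; set q := al *: _.
  by rewrite -addrA -opprD (addrC q p) addrA addrAC addrK.
move: b0; rewrite !cva_tau => /(congr1 (fun w => dot w Z)).
rewrite dot0l => <-.
by rewrite 8!dotDl (dotcva ord0) (dotcva ord_max).
Qed.

Lemma pa_nat a n : pa a n%:R = 0.
Proof. by rewrite /pa big1// => i _; rewrite raddfMn /= der1 mul0rn mulr0. Qed.

Section Biharmonic.
Hypothesis dd0 : dd = 0.
Hypothesis bih : bit eps x = 0.

Lemma va_tau a : va a tau = 2%:R *: (pa a f *: e3 + f *: va a e3).
Proof.
by rewrite tau_e3 vaZ paM pa_nat mul0r add0r scalerDr !scalerA.
Qed.

Lemma V1tau : va ord0 tau =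
  (2%:R * pa ord0 f) *: e3 - (2%:R * f * (f + aa)) *: e1 + (2%:R * f * w1) *: e4.
Proof.
by rewrite va_tau V1e3 scaleNr !(scalerDr, scalerN) !scalerA !addrA.
Qed.

Lemma V2tau : va ord_max tau = (2%:R * pa ord_max f) *: e3
  - (2%:R * f * (f - aa)) *: e2 + (2%:R * f * w2) *: e4.
Proof.
by rewrite va_tau V2e3 scaleNr !(scalerDr, scalerN) !scalerA !addrA.
Qed.

Lemma dot_va2 a u Z : dot (va a (va a u)) Z =
  pa a (dot (va a u) Z) - dot (va a u) (va a Z).
Proof. by rewrite pa_dot addrK. Qed.

Lemma bih_eq Z : dot nv Z = 0 ->
  pa ord0 (dot (va ord0 tau) Z) - dot (va ord0 tau) (va ord0 Z)
  + pa ord_max (dot (va ord_max tau) Z) - dot (va ord_max tau) (va ord_max Z)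
  - al * dot (va ord_max tau) Z - be * dot (va ord0 tau) Z
  + epsA * 2%:R * dot tau Z = 0.
Proof.
move=> nZ; have := bit_frame nZ bih.
by rewrite 4!dotDl !(dotNl, dotZl) (dot_va2 ord0) (dot_va2 ord_max) !addrA.
Qed.

Lemma pa1_aa : pa ord0 aa = pa ord0 f + 2%:R * aa * be + w1 * bb.
Proof.
have := codazzi3_1 dd0; rewrite (paB _ f aa) => s.
by apply: eq_of_subN s _; ring.
Qed.

Lemma pa2_aa : pa ord_max aa = - pa ord_max f + 2%:R * aa * al + w2 * bb.
Proof.
have := codazzi3_2 dd0; rewrite (paD _ f aa) => s.
by apply: eq_of_sub s _; ring.
Qed.

(** The four components of the biharmonic equation; the Codazzi equations remove
the derivatives of aa from the tangential ones. *)
Lemma bih1 : (2%:R * f + aa) * pa ord0 f + f * bb * w1 = 0.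
Proof.
have := bih_eq (nv_fr ord0); rewrite V1tau V2tau tau_e3 V1e1 V2e1 dd0 !expand.
rewrite !(paN, paM, paD _ f aa, paB _ f aa, pa_nat) pa1_aa => s.
by apply/two_inj/two_inj/(eq_of_subN s); ring.
Qed.

Lemma bih2 : (2%:R * f - aa) * pa ord_max f - f * bb * w2 = 0.
Proof.
have := bih_eq (nv_fr ord_max); rewrite V1tau V2tau tau_e3 V1e2 V2e2 dd0 !expand.
rewrite !(paN, paM, paD _ f aa, paB _ f aa, pa_nat) pa2_aa => s.
by apply/two_inj/two_inj/(eq_of_subN s); ring.
Qed.

Lemma bih3 : pa ord0 (pa ord0 f) + pa ord_max (pa ord_max f)
  - al * pa ord_max f - be * pa ord0 f - f * (w1 ^+ 2 + w2 ^+ 2)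
  - 2%:R * f * (f ^+ 2 + aa ^+ 2) + 2%:R * epsA * f = 0.
Proof.
have := bih_eq nv_e3; rewrite V1tau V2tau tau_e3 V1e3 V2e3 !expand.
rewrite !(paN, paM, paD _ f aa, paB _ f aa, pa_nat) => s.
by apply/two_inj/(eq_of_sub s); ring.
Qed.

Lemma bih4 : 2%:R * (w1 * pa ord0 f + w2 * pa ord_max f)
  + f * (pa ord0 w1 + pa ord_max w2 - al * w2 - be * w1)
  - 2%:R * f * aa * bb = 0.
Proof.
have := bih_eq nv_e4; rewrite V1tau V2tau tau_e3 V1e4 V2e4 dd0 !expand.
rewrite !(paN, paM, paD _ f aa, paB _ f aa, pa_nat) => s.
by apply/two_inj/(eq_of_sub s); ring.
Qed.

End Biharmonic.

Lemma dot_nor v w : (forall i, dot w (xd i) = 0) -> dot (nor eps x v) w = dot v w.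
Proof.
move=> w0; rewrite norE dotDl dotNl dot_suml big1 ?subr0// => i _.
by rewrite dot_suml big1// => j _; rewrite dotZl (dotC eps (xd j)) w0 mulr0.
Qed.

Lemma nor_xd v l : dot (nor eps x v) (xd l) = 0.
Proof.
rewrite norE dotDl dotNl; apply/eqP; rewrite subr_eq0; apply/eqP.
rewrite dot_suml; under eq_bigr do rewrite dot_suml.
have -> : \sum_i \sum_j dot ((gi i j * dot v (xd i)) *: xd j) (xd l) =
    \sum_i dot v (xd i) * \sum_j gi i j * gm j l.
  apply: eq_bigr => i _; rewrite mulr_sumr; apply: eq_bigr => j _.
  by rewrite dotZl gmE; ring.
rewrite (bigD1 l)//= [X in _ + X]big1 => [|i /negbTE il].
  by rewrite (gi_gm x_space_form x_free) eqxx mulr1 addr0.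
by rewrite (gi_gm x_space_form x_free) il mulr0.
Qed.

Definition wi i : A := dot (vder i e3) e4.

Lemma ncon_e3 i : ncon eps x i e3 = wi i *: e4.
Proof.
have d33 : dot (vder i e3) e3 = 0.
  have /(congr1 (der i)) := e33; rewrite der_dot der1 (dotC eps e3) => d.
  by apply: two_inj; rewrite mulr_natl mulr2n.
have t b : dot (ncon eps x i e3) (fr b) = 0.
  by rewrite dot_fr big1// => j _; rewrite nor_xd mulr0.
rewrite [LHS]expansion !t !scale0r !add0r /ncon.
rewrite (dot_nor _ e3_xd) (dot_nor _ e4_xd) (dot_nor _ nv_xd) (con_nv x_space_form)//.
by rewrite !nv_con ?nv_e3 ?nv_e4// d33 mulr0 !scale0r add0r addr0.
Qed.

Lemma dot_ncon_e4 i (h : A) : dot (ncon eps x i (h *: e4)) e4 = der i h.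
Proof.
have d44 : dot (vder i e4) e4 = 0.
  have /(congr1 (der i)) := e44; rewrite der_dot der1 (dotC eps e4) => d.
  by apply: two_inj; rewrite mulr_natl mulr2n.
rewrite /ncon (dot_nor _ e4_xd) nv_con ?nv_e4// vderZ dotDl !dotZl e44 d44.
by rewrite mulr0 addr0 mulr1.
Qed.

Lemma w1E : w1 = \sum_i c ord0 i * wi i.
Proof. by rewrite /w1 dot_suml; apply: eq_bigr => i _; rewrite dotZl. Qed.

Lemma w2E : w2 = \sum_i c ord_max i * wi i.
Proof. by rewrite /w2 dot_suml; apply: eq_bigr => i _; rewrite dotZl. Qed.

(** The normal curvature in the coordinate frame is the exterior derivative of the
normal connection form, here expressed in the moving frame. *)
Lemma flat_closed :
  ncon eps x ord0 (ncon eps x ord_max e3) - ncon eps x ord_max (ncon eps x ord0 e3) = 0 ->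
  pa ord0 w2 - pa ord_max w1 + al * w1 - be * w2 = 0.
Proof.
rewrite !ncon_e3 => /(congr1 (fun v => dot v e4)).
rewrite /= dotDl dotNl !dot_ncon_e4 dot0l => d01.
have E a b : pa a (\sum_i c b i * wi i) = pa a (c b ord0) * wi ord0 +
    pa a (c b ord_max) * wi ord_max +
    (c b ord0 * (c a ord0 * der ord0 (wi ord0) + c a ord_max * der ord_max (wi ord0)) +
     c b ord_max * (c a ord0 * der ord0 (wi ord_max) + c a ord_max * der ord_max (wi ord_max))).
  by rewrite sumI2 paD !paM [in pa a (wi _)]/pa; rewrite /pa !sumI2; ring.
have b0 := brkE ord0; have b1 := brkE ord_max; rewrite /brk in b0 b1.
rewrite w1E w2E !E !sumI2.
have s := congr2 (fun y z => y * wi ord0 + z * wi ord_max) b0 b1.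
have {}s := congr2 (fun y z => y + (c ord0 ord0 * c ord_max ord_max
   - c ord0 ord_max * c ord_max ord0) * z) s d01.
apply: eq_of_sub s _ => /=; ring.
Qed.

Lemma dot_Bf i j k l : dot (Bf i j) (Bf k l) =
  dot (Bf i j) e3 * dot (Bf k l) e3 + dot (Bf i j) e4 * dot (Bf k l) e4.
Proof.
have t i' j' b : dot (Bf i' j') (fr b) = 0.
  by rewrite dot_fr big1// => m _; rewrite (Bf_xd x_space_form x_free) mulr0.
rewrite {1}[Bf k l]expansion !t (Bf_nv x_space_form) mulr0 !scale0r !add0r addr0.
by rewrite dotDr !dotZr; ring.
Qed.

(** For curvature eps the Gauss equation says that the determinants of the two
components of the second fundamental form add up to zero; passing to the moving
frame multiplies both by the square of det c. *)
Lemma gauss_extrinsic : dd = 0 ->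
  dot (Bf ord_max ord_max) (Bf ord0 ord0) = dot (Bf ord0 ord_max) (Bf ord_max ord0) ->
  aa ^+ 2 + bb ^+ 2 = f ^+ 2.
Proof.
move=> dd0; rewrite !dot_Bf (BfC eps x ord_max ord0) => BB.
have F a b v : (forall i, dot v (xd i) = 0) -> dot v nv = 0 ->
    dot (va a (fr b)) v = c a ord0 * c b ord0 * dot (Bf ord0 ord0) v +
      (c a ord0 * c b ord_max + c a ord_max * c b ord0) * dot (Bf ord0 ord_max) v +
      c a ord_max * c b ord_max * dot (Bf ord_max ord_max) v.
  by move=> v0 vn; rewrite va_fr// !sumI2 (BfC eps x ord_max ord0); ring.
have h11 := h3_11; have h22 := h3_22; have h12 := eigen.
have k11 : dot (va ord0 e1) e4 = bb by []. have k22 := h4_22.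
have k12 : dot (va ord0 e2) e4 = 0 by exact: dd0.
move: BB h11 h22 h12 k11 k22 k12; rewrite !F//.
set p := dot (Bf ord0 ord0) e3; set q := dot (Bf ord0 ord_max) e3.
set r := dot (Bf ord_max ord_max) e3.
set p' := dot (Bf ord0 ord0) e4; set q' := dot (Bf ord0 ord_max) e4.
set r' := dot (Bf ord_max ord_max) e4.
move=> BB h11 h22 h12 k11 k22 k12.
have s3 : (f + aa) * (f - aa) =
    (c ord0 ord0 * c ord_max ord_max - c ord0 ord_max * c ord_max ord0) ^+ 2
    * (p * r - q ^+ 2).
  rewrite -h11 -h22 -[LHS]subr0 -(mulr0 0) -{1}h12 -h12; ring.
have s4 : bb * (- bb) =
    (c ord0 ord0 * c ord_max ord_max - c ord0 ord_max * c ord_max ord0) ^+ 2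
    * (p' * r' - q' ^+ 2).
  rewrite -{1}k11 -k22 -[LHS]subr0 -(mulr0 0) -{1}k12 -k12; ring.
have B0 : p * r - q ^+ 2 + (p' * r' - q' ^+ 2) = 0.
  by apply: eq_of_sub BB _; ring.
have {}s3 := congr2 (fun y z => y + z) s3 s4; rewrite /= -mulrDr B0 mulr0 in s3.
by apply: eq_of_subN s3 _; ring.
Qed.

Lemma pa_derivation a : derivation (pa a).
Proof.
by split; [exact: paD|exact: paM|exact: paN|exact: pa_nat|exact: pa_cst].
Qed.

(** Flatness makes the left-hand side of the Ricci equation vanish, so dd = 0 since
aa vanishes nowhere: the two shape operators are diagonal in the same frame. *)
Lemma frame_bih_system :
  positive f -> nowhere0 aa ->
  (forall p, U p -> pa ord0 f p != 0 \/ pa ord_max f p != 0) ->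
  ncon eps x ord0 (ncon eps x ord_max e3) - ncon eps x ord_max (ncon eps x ord0 e3) = 0 ->
  dot (Bf ord_max ord_max) (Bf ord0 ord0) = dot (Bf ord0 ord_max) (Bf ord_max ord0) ->
  bit eps x = 0 ->
  bih_system eps (pa ord0) (pa ord_max) f aa bb al be w1 w2.
Proof.
move=> f_gt0 aa0 gradf flat BB bih.
have closed := flat_closed flat.
have dd0 : dd = 0.
  have := ricci; rewrite closed => r.
  apply: sfunP => p Up; have := congr1 (fun h : A => h p) r.
  rewrite sfunNE// !sfunME// sfun0E// sfun_natE// => /esym/eqP.
  by rewrite oppr_eq0 !mulf_eq0 (negbTE (aa0 p Up)) pnatr_eq0 => /eqP.
have abf := gauss_extrinsic dd0 BB.
split=> //; try exact: pa_derivation.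
- exact: pa_comm.
- exact: codazzi3_2.
- exact: codazzi3_1.
- exact: codazzi4_2.
- exact: codazzi4_1.
- by rewrite gauss// -abf; ring.
- exact: bih1.
- exact: bih2.
- exact: bih3.
- exact: bih4.
Qed.

End MovingFrame.

(** * The eigenframe of a local surface *)

(** The pointwise hypotheses on a parametrized surface, which pass to smaller open
sets. *)
Record local_surface (R : realType) (eps : R) (X : 'rV[R]_2 -> 'rV[R]_5)
    (U : set 'rV[R]_2) : Prop := LocalSurface {
  ls_smooth : smooth_on U X ;
  ls_space_form : forall p, U p -> space_form eps (X p) ;
  ls_free : forall p, U p -> row_free ('J X p) ;
  ls_H : forall p, U p -> mean_curv eps X p != 0 ;
  ls_grad : forall p, U p -> grad eps X (mean_curv_norm eps X) p != 0 ;
  ls_shape : forall p, U p ->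
    Defs.shape eps X (E3 eps X) p != (mean_curv_norm eps X p)%:M ;
  ls_gauss : forall p, U p -> gauss_curv eps X p = eps ;
  ls_bih : forall p, U p -> bitension eps X p = 0
}.

Lemma local_surface_sub (R : realType) (eps : R) X (U V : set 'rV[R]_2) :
  V `<=` U -> local_surface eps X U -> local_surface eps X V.
Proof.
move=> VU [sX sf fr H gr sh ga bi]; split=> [k|p|p|p|p|p|p|p];
  by [exact: Ck_sub VU (sX k)|move=> /VU; auto].
Qed.

Section Localization.
Variables (R : realType) (eps : R) (X : 'rV[R]_2 -> 'rV[R]_5) (U : domain R).
Local Notation plane := 'rV[R]_2.
Local Notation A := (sfun U).
Local Notation vec := 'rV[A]_5.
Local Notation dot := (@dot R eps U).
Hypothesis XU : local_surface eps X U.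
Variable x : vec.
Hypothesis Xx : vrepr X x.
Local Notation xd := (xd x).
Local Notation gm := (gm eps x).
Local Notation gi := (gi eps x).
Local Notation Bf := (Bf eps x).
Local Notation gmE := (gmE eps x).
Local Notation nv := (nv eps x).
Local Notation tau := (tau eps x).
Local Notation Hv := (Hv eps x).

Lemma x_sf p : U p -> space_form eps (evv p x).
Proof. by move=> Up; rewrite -Xx//; exact: (ls_space_form XU). Qed.

Lemma x_free p : U p -> forall c0 c1 : R,
  c0 *: evv p (xd ord0) + c1 *: evv p (xd ord_max) = 0 -> c0 = 0 /\ c1 = 0.
Proof.
move=> Up c0 c1 e; have dX : differentiable X p by apply: (ls_smooth XU 1).1.
have xdJ i : evv p (xd i) = delta_mx 0 i *m 'J X p.
  by rewrite -(pdX Xx)// /pd deriveEjacobian.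
have {}e : (c0 *: delta_mx 0 ord0 + c1 *: delta_mx 0 ord_max : plane) *m 'J X p = 0.
  by rewrite mulmxDl -!scalemxAl -!xdJ.
have c0E : c0 *: delta_mx 0 ord0 + c1 *: delta_mx 0 ord_max = 0 :> plane.
  by apply: (row_free_inj (ls_free XU Up)); rewrite e mul0mx.
by split; [have /rowP/(_ ord0) := c0E | have /rowP/(_ ord_max) := c0E];
  rewrite !mxE /= ?mulr1 ?mulr0 ?addr0 ?add0r.
Qed.

Let gmu := gm_unit x_sf x_free.

Lemma Hv_xd l : dot Hv (xd l) = 0.
Proof. by rewrite dotZl (tau_xd x_sf x_free) mulr0. Qed.

Lemma Hv_nv : dot Hv nv = 0.
Proof. by rewrite dotZl (tau_nv x_sf) mulr0. Qed.

Lemma Hv_gt0 : positive (dot Hv Hv).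
Proof.
move=> p Up; apply: (dot_gt0 x_sf) => //; first by rewrite dotC Hv_nv.
by rewrite -(mean_curv_repr Xx gmu)//; exact: (ls_H XU).
Qed.

Definition fH : A := ssqrt (dot Hv Hv).
Definition e3H : vec := fH^-1 *: Hv.

Lemma fH_gt0 : positive fH. Proof. exact/ssqrt_positive/Hv_gt0. Qed.

Lemma fH_unit : fH \is a GRing.unit.
Proof. exact/sunitP/positive_nowhere0/fH_gt0. Qed.

Lemma fH_repr : repr (mean_curv_norm eps X) fH.
Proof.
move=> p Up; rewrite /mean_curv_norm (mean_curv_repr Xx gmu)// -evv_dot//.
by rewrite ssqrtE//; exact: Hv_gt0.
Qed.

Lemma e3H_repr : vrepr (E3 eps X) e3H.
Proof.
move=> p Up; rewrite [RHS](evvZ Up) /E3 fH_repr// (mean_curv_repr Xx gmu)//.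
by rewrite sfunVE//; exact/positive_nowhere0/fH_gt0.
Qed.

Lemma e3H_xd l : dot e3H (xd l) = 0. Proof. by rewrite dotZl Hv_xd mulr0. Qed.
Lemma e3H_nv : dot e3H nv = 0. Proof. by rewrite dotZl Hv_nv mulr0. Qed.

Lemma e3H_e3H : dot e3H e3H = 1.
Proof.
rewrite dotZl dotZr -(sqr_ssqrt Hv_gt0) -/fH expr2 (mulrA fH^-1 fH).
by rewrite mulVr ?fH_unit// mul1r mulVr ?fH_unit.
Qed.

Lemma tau_e3H : tau = (2%:R * fH) *: e3H.
Proof.
by rewrite tauE /e3H -scalerA (scalerA fH) mulrV ?fH_unit// scale1r.
Qed.

Definition h3 i j : A := dot (Bf i j) e3H.

(** The traceless part of the second fundamental form in the direction of H. *)
Definition k3 i j : A := h3 i j - fH * gm i j.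

Lemma k3C i j : k3 i j = k3 j i.
Proof. by rewrite /k3 /h3 (BfC eps x) (gmC eps x). Qed.

Lemma k3_trace : gm ord0 ord0 * k3 ord_max ord_max
  + gm ord_max ord_max * k3 ord0 ord0 - 2%:R * gm ord0 ord_max * k3 ord0 ord_max = 0.
Proof.
have tr : \sum_i \sum_j gi i j * k3 i j = 0.
  have -> : \sum_i \sum_j gi i j * k3 i j =
      dot tau e3H - fH * \sum_i \sum_j gi i j * gm i j.
    rewrite dot_suml mulr_sumr -sumrB; apply: eq_bigr => i _.
    rewrite dot_suml mulr_sumr -sumrB; apply: eq_bigr => j _.
    by rewrite dotZl /k3 /h3; ring.
  by rewrite tau_e3H dotZl e3H_e3H (trace_gm x_sf x_free); ring.
have g00 := gm_gi x_sf x_free ord0 ord0; have g01 := gm_gi x_sf x_free ord0 ord_max.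
have g10 := gm_gi x_sf x_free ord_max ord0; have g11 := gm_gi x_sf x_free ord_max ord_max.
move: tr g00 g01 g10 g11; rewrite !sumI2 /= (gmC eps x ord_max) (k3C ord_max).
rewrite (giC eps x ord_max).
move: (gm ord0 ord0) (gm ord0 ord_max) (gm ord_max ord_max) (gi ord0 ord0)
  (gi ord0 ord_max) (gi ord_max ord_max) (k3 ord0 ord0) (k3 ord0 ord_max) (k3 ord_max ord_max).
move=> a b c a' b' c' k l m tr g00 g01 g10 g11.
have A1 : (a * c - b ^+ 2) * a' = c.
  apply: (eq_of_sub (congr2 (fun y z => c * y - b * z) g00 g10)) => /=; ring.
have A2 : (a * c - b ^+ 2) * b' = - b.
  apply: (eq_of_sub (congr2 (fun y z => a * y - b * z) g10 g00)) => /=; ring.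
have A3 : (a * c - b ^+ 2) * c' = a.
  apply: (eq_of_sub (congr2 (fun y z => a * y - b * z) g11 g01)) => /=; ring.
apply: etrans (_ : (a * c - b ^+ 2) * 0 = 0); last exact: mulr0.
by rewrite -tr -{1}A3 -[X in _ + X * k - _]A1 -[X in _ - _ * X * _]opprK -A2; ring.
Qed.

(** The square of half the difference of the eigenvalues of the shape operator
in the direction of H. *)
Definition asq : A := fH ^+ 2 -
  (h3 ord0 ord0 * h3 ord_max ord_max - h3 ord0 ord_max ^+ 2) * (\det gm)^-1.

Lemma det_k3 : k3 ord0 ord0 * k3 ord_max ord_max - k3 ord0 ord_max ^+ 2 = - (asq * \det gm).
Proof.
have t := k3_trace; have d := det_gmE eps x.
have dV : (\det gm)^-1 * \det gm = 1.
  by rewrite mulVr//; apply/sunitP/positive_nowhere0/(det_gm_gt0 x_sf x_free).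
have -> : asq * \det gm = fH ^+ 2 * \det gm -
    (h3 ord0 ord0 * h3 ord_max ord_max - h3 ord0 ord_max ^+ 2).
  by rewrite /asq mulrBl -(mulrA _ _^-1) dV mulr1.
rewrite d; move: t; rewrite /k3 => t.
by apply: (eq_of_sub (congr1 ( *%R (- fH)) t)); ring.
Qed.

(** The traceless part is symmetric and, by hypothesis, nonzero; its determinant
is therefore negative, and this determinant is - asq * det g. *)
Lemma asq_gt0 : positive asq.
Proof.
move=> p Up; have g0 := gm00_gt0 x_sf x_free Up; have d0 := det_gm_gt0 x_sf x_free Up.
have k0 : ~ (forall i j, k3 i j p = 0).
  move=> k0; have /eqP := ls_shape XU Up; apply.
  have -> : Defs.shape eps X (E3 eps X) p =
      mean_curv_norm eps X p *: (metric eps X p *m metric_inv eps X p).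
    rewrite /Defs.shape scalemxAl; congr (_ *m _); apply/matrixP => i j.
    rewrite [LHS]mxE (sff_repr Xx gmu)// e3H_repr// -evv_dot// -/(h3 i j).
    rewrite [RHS]mxE (metric_repr eps Xx i j Up) fH_repr// -sfunME//.
    by apply/eqP; rewrite -subr_eq0 -sfunNE// -sfunDE// -/(k3 i j) k0.
  rewrite /metric_inv mulmxV ?scalemx1//.
  by rewrite unitmxE unitfE (det_metric_repr eps Xx Up) gt_eqF.
have {}k0 : ~ [/\ k3 ord0 ord0 p = 0, k3 ord0 ord_max p = 0 & k3 ord_max ord_max p = 0].
  move=> [k00 k01 k11]; apply: k0; apply: I2_ind; apply: I2_ind => //.
  by rewrite k3C.
move: k3_trace det_k3 (det_gmE eps x) g0 d0 k0.
move: (gm ord0 ord0) (gm ord0 ord_max) (gm ord_max ord_max) (\det gm)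
  (k3 ord0 ord0) (k3 ord0 ord_max) (k3 ord_max ord_max) asq.
move=> a b c d k l m s t dk dg.
have := congr1 (fun h : A => h p) t; have := congr1 (fun h : A => h p) dk.
have := congr1 (fun h : A => h p) dg.
rewrite sfun0E// !(sfunDE, sfunNE, sfunME, sfunXE, sfun_natE)//.
move: (a p) (b p) (c p) (d p) (k p) (l p) (m p) (s p).
clear; move=> a b c d k l m s dg dk t a0 d0 k0.
rewrite -(pmulr_lgt0 _ d0) -oppr_lt0 -dk -(pmulr_rlt0 _ (exprn_gt0 2 a0)).
have -> : a ^+ 2 * (k * m - l ^+ 2) = - ((a * l - b * k) ^+ 2 + k ^+ 2 * d).
  rewrite dg -[LHS]addr0 -(mulr0 (- (a * k))) -t; ring.
rewrite oppr_lt0; have [k00|kn0] := eqVneq k 0; last first.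
  by rewrite ltr_wpDl ?sqr_ge0// mulr_gt0// exprn_even_gt0.
have l0 : l != 0.
  apply/eqP => l00; apply: k0; split=> //; apply/eqP; move/eqP : t.
  by rewrite k00 l00 !mulr0 addr0 subr0 mulf_eq0 gt_eqF.
have al0 : a * l != 0 by rewrite mulf_neq0// gt_eqF.
by rewrite k00 mulr0 subr0 expr0n /= mul0r addr0 exprn_even_gt0.
Qed.

Section EigenFrame.
Variables (i0 : 'I_2) (sg : R).
Hypothesis sg2 : sg ^+ 2 = 1.

Definition eigv : A := scst U sg * ssqrt asq.

(** The second coordinate of an eigenvector for the eigenvalue eigv of the traceless
part; the first one is k3 ord0 ord_max - eigv * gm ord0 ord_max. *)
Definition piv : A := eigv * gm ord0 ord0 - k3 ord0 ord0.
Definition e4N : A := dot (ncon eps x i0 e3H) (ncon eps x i0 e3H).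

Lemma sqr_eigv : eigv ^+ 2 = asq.
Proof.
rewrite /eigv exprMn (sqr_ssqrt asq_gt0); apply: sfunP => p Up.
by rewrite sfunME// sfunXE// scstE// sg2 mul1r.
Qed.

Lemma eigv_neq0 : nowhere0 eigv.
Proof.
move=> p Up; rewrite -sqrf_eq0 -sfunXE// sqr_eigv gt_eqF//; exact: asq_gt0.
Qed.

Lemma ncon_e3H_xd l : dot (ncon eps x i0 e3H) (xd l) = 0.
Proof. exact: nor_xd x_sf x_free _ _. Qed.

Lemma ncon_e3H_nv : dot (ncon eps x i0 e3H) nv = 0.
Proof.
by rewrite dot_nor; [exact: con_nv x_sf _ _ e3H_nv|exact: nv_xd x_sf].
Qed.

Lemma e3H_ncon : dot e3H (ncon eps x i0 e3H) = 0.
Proof.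
rewrite dotC dot_nor; last exact: e3H_xd.
rewrite nv_con; last by rewrite dotC e3H_nv.
apply: two_inj; have /(congr1 (der i0)) := e3H_e3H.
by rewrite der_dot der1 (dotC eps e3H) mulr_natl mulr2n.
Qed.

Hypothesis piv0 : nowhere0 piv.
Hypothesis e4N0 : nowhere0 e4N.

Lemma e4N_gt0 : positive e4N.
Proof.
move=> p Up; apply: (dot_gt0 x_sf) => //; first by rewrite dotC ncon_e3H_nv.
apply: contra_neq (e4N0 Up) => e; rewrite /e4N evv_dot// e.
by rewrite -(evv0 Up) -evv_dot// dot0l sfun0E.
Qed.

Definition e4H : vec := (ssqrt e4N)^-1 *: ncon eps x i0 e3H.

Lemma e4H_e4H : dot e4H e4H = 1.
Proof.
have u : ssqrt e4N \is a GRing.unit.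
  exact/sunitP/positive_nowhere0/ssqrt_positive/e4N_gt0.
rewrite dotZl dotZr -[dot (ncon _ _ _ _) _]/e4N -{3}(sqr_ssqrt e4N_gt0) expr2.
by rewrite mulKr// mulVr.
Qed.
Lemma e4H_xd l : dot e4H (xd l) = 0. Proof. by rewrite dotZl ncon_e3H_xd mulr0. Qed.
Lemma e4H_nv : dot e4H nv = 0. Proof. by rewrite dotZl ncon_e3H_nv mulr0. Qed.
Lemma e3H_e4H : dot e3H e4H = 0. Proof. by rewrite dotZr e3H_ncon mulr0. Qed.

Let v0 : A := k3 ord0 ord_max - eigv * gm ord0 ord_max.
Let v1 : A := piv.
Let vN : A := gm ord0 ord0 * v0 ^+ 2 + 2%:R * gm ord0 ord_max * v0 * v1
  + gm ord_max ord_max * v1 ^+ 2.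

(** The squared norm of the eigenvector is positive as its second coordinate, the
pivot, vanishes nowhere. *)
Lemma vN_gt0 : positive vN.
Proof.
move=> p Up; have g0 := gm00_gt0 x_sf x_free Up; have d0 := det_gm_gt0 x_sf x_free Up.
have v10 := piv0 Up; rewrite det_gmE -/v1 in d0 v10; rewrite /vN.
move: (gm ord0 ord0) (gm ord0 ord_max) (gm ord_max ord_max) v0 v1 g0 d0 v10.
move=> a b c v w; rewrite !(sfunDE, sfunNE, sfunME, sfunXE, sfun_natE)//.
move: (a p) (b p) (c p) (v p) (w p) => {}a {}b {}c {}v {}w a0 d0 w0.
rewrite -(pmulr_rgt0 _ a0).
have -> : a * (a * v ^+ 2 + 2 * b * v * w + c * w ^+ 2) =
  (a * v + b * w) ^+ 2 + (a * c - b ^+ 2) * w ^+ 2 by ring.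
by rewrite ltr_wpDl ?sqr_ge0// mulr_gt0// exprn_even_gt0.
Qed.

Let r1 : A := (ssqrt vN)^-1.
Let r2 : A := (ssqrt (vN * \det gm))^-1.

(** The first row is the normalized eigenvector; the second one is its rotation by
a right angle, normalized. *)
Definition eigc : 'M[A]_2 := \matrix_(i, j)
  if i == ord0 then r1 * (if j == ord0 then v0 else v1)
  else r2 * (if j == ord0 then - (gm ord0 ord_max * v0 + gm ord_max ord_max * v1)
             else gm ord0 ord0 * v0 + gm ord0 ord_max * v1).

Lemma sqr_ssqrtV (h : A) : positive h -> (ssqrt h)^-1 ^+ 2 * h = 1.
Proof.
move=> h0; rewrite -{2}(sqr_ssqrt h0) -exprMn mulVr ?expr1n//.
exact/sunitP/positive_nowhere0/ssqrt_positive.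
Qed.

Lemma vNd_gt0 : positive (vN * \det gm).
Proof.
move=> p Up; rewrite sfunME// mulr_gt0//; first exact: vN_gt0.
exact: (det_gm_gt0 x_sf x_free).
Qed.

Lemma eigc_orth a b : dot (fr x eigc a) (fr x eigc b) = (a == b)%:R.
Proof.
have E c d : dot (fr x eigc c) (fr x eigc d) =
    eigc c ord0 * eigc d ord0 * gm ord0 ord0 +
    (eigc c ord0 * eigc d ord_max + eigc c ord_max * eigc d ord0) * gm ord0 ord_max +
    eigc c ord_max * eigc d ord_max * gm ord_max ord_max.
  rewrite dot_fr sumI2 !(dotC eps (fr x eigc c)) !dot_fr !sumI2 -!gmE.
  rewrite (gmC eps x ord_max); ring.
have q1 : r1 ^+ 2 * vN = 1 by exact: sqr_ssqrtV vN_gt0.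
have q2 : r2 ^+ 2 * (vN * (gm ord0 ord0 * gm ord_max ord_max - gm ord0 ord_max ^+ 2)) = 1.
  by rewrite -det_gmE; exact: sqr_ssqrtV vNd_gt0.
rewrite E !mxE /=.
move: a b; apply: I2_ind; apply: I2_ind => /=.
- by rewrite -q1 /vN; ring.
- ring.
- ring.
- by rewrite -q2 /vN; ring.
Qed.

Local Notation e1 := (fr x eigc ord0).
Local Notation e2 := (fr x eigc ord_max).

(** The first equation holds by the choice of the coordinates; the second one
combines trace zero with the value of the determinant. *)
Lemma k3_eigen : k3 ord0 ord0 * v0 + k3 ord0 ord_max * v1 =
    eigv * (gm ord0 ord0 * v0 + gm ord0 ord_max * v1) /\
  k3 ord0 ord_max * v0 + k3 ord_max ord_max * v1 =
    eigv * (gm ord0 ord_max * v0 + gm ord_max ord_max * v1).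
Proof.
have t := k3_trace; have dk := det_k3; rewrite -sqr_eigv det_gmE in dk.
rewrite /v0 /v1 /piv; split; first by ring.
by apply: (eq_of_sub (congr2 (fun y z => eigv * y - z) t dk)) => /=; ring.
Qed.

Lemma frame_h3 a b : dot (va eigc a (fr x eigc b)) e3H =
  \sum_i \sum_j eigc a i * eigc b j * k3 i j + fH * dot (fr x eigc a) (fr x eigc b).
Proof.
have -> : dot (fr x eigc a) (fr x eigc b) =
    \sum_i \sum_j eigc a i * eigc b j * gm i j.
  rewrite dotC dot_fr; apply: eq_bigr => i _; rewrite dotC dot_fr mulr_sumr.
  by apply: eq_bigr => j _; rewrite gmE mulrA.
rewrite (va_fr _ _ _ e3H_xd e3H_nv) mulr_sumr -big_split; apply: eq_bigr => i _ /=.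
rewrite mulr_sumr -big_split; apply: eq_bigr => j _ /=.
by rewrite /k3 /h3; ring.
Qed.

Lemma eigen_h3 : dot (va eigc ord0 e2) e3H = 0.
Proof.
have [E0 E1] := k3_eigen; rewrite frame_h3 eigc_orth mulr0 addr0 !sumI2 !mxE /=.
rewrite (k3C ord_max).
have s := congr2 (fun y z => - (gm ord0 ord_max * v0 + gm ord_max ord_max * v1) * y +
  (gm ord0 ord0 * v0 + gm ord0 ord_max * v1) * z) E0 E1.
by apply: (eq_of_sub (congr1 ( *%R (r1 * r2)) s)) => /=; ring.
Qed.

Lemma aa_eigv : aa eps x eigc e3H fH = eigv.
Proof.
have [E0 E1] := k3_eigen; rewrite /aa frame_h3 eigc_orth eqxx mulr1 addrK !sumI2 !mxE /=.
rewrite (k3C ord_max).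
have q1 : r1 ^+ 2 * vN = 1 by exact: sqr_ssqrtV vN_gt0.
have s := congr2 (fun y z => v0 * y + v1 * z) E0 E1.
rewrite -[RHS]mulr1 -q1 /vN.
by apply: (eq_of_sub (congr1 ( *%R (r1 ^+ 2)) s)) => /=; ring.
Qed.

Hypothesis flat : forall p, U p ->
  normal_curv eps X ord0 ord_max (E3 eps X) p = 0.

Lemma eigen_frame_false : False.
Proof.
apply: (@bih_system_false R eps U (pa eigc ord0) (pa eigc ord_max) fH
  (aa eps x eigc e3H fH) (bb eps x eigc e4H) (al eps x eigc) (be eps x eigc)
  (w1 eps eigc e3H e4H) (w2 eps eigc e3H e4H)).
apply: (frame_bih_system x_sf x_free eigc_orth e3H_e3H e4H_e4H e3H_e4H e3H_xd e4H_xd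
  e3H_nv e4H_nv tau_e3H eigen_h3).
- exact: fH_gt0.
- by rewrite aa_eigv; exact: eigv_neq0.
- move=> p Up; apply/orP; rewrite -negb_and; apply/negP => /andP[/eqP p1 /eqP p2].
  have /eqP := ls_grad XU Up; apply; apply/rowP => k; rewrite !mxE.
  transitivity ((\sum_a eigc a k * pa eigc a fH) p).
    have -> : \sum_a eigc a k * pa eigc a fH = \sum_j gi k j * der j fH.
      under eq_bigr do rewrite mulr_sumr.
      rewrite exchange_big; apply: eq_bigr => j _ /=.
      rewrite (gi_fr x_sf x_free eigc_orth) mulr_suml; apply: eq_bigr => a _.
      by rewrite mulrA.
    rewrite sfun_sumE//; apply: eq_bigr => j _.
    by rewrite sfunME// (metric_inv_repr Xx gmu)// (pd_repr j fH_repr Up).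
  by rewrite sumI2 sfunDE// !sfunME// p1 p2 !mulr0 addr0.
- apply: evvP => p Up; rewrite evv0//.
  by rewrite -(normal_curv_repr Xx gmu ord0 ord_max e3H_repr) ?flat.
- have BB := riem_gm x_sf x_free ord0 ord_max ord_max ord0.
  have gc : \sum_l riem eps x l ord0 ord_max ord_max * gm l ord0 = scst U eps * \det gm.
    apply: sfunP => p Up; rewrite -(gauss_curv_repr Xx gmu)// sfunME// scstE//.
    by rewrite (ls_gauss XU).
  rewrite gc det_gmE (gmC eps x ord_max ord0) in BB.
  by apply: eq_of_subN BB _; ring.
- apply: evvP => p Up; rewrite evv0//.
  by rewrite -(bitension_repr Xx gmu)//; exact: (ls_bih XU).
Qed.

End EigenFrame.

(** The pivot and the squared norm of the normal derivative of E3 in terms of the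
immersion itself: independent of the domain, they identify the two quantities
over a domain with those over a smaller one. *)
Definition pivR (sg f h00 h01 h11 g00 d : R) : R :=
  sg * Num.sqrt (f ^+ 2 - (h00 * h11 - h01 ^+ 2) * d^-1) * g00 - (h00 - f * g00).

Definition pivF (sg : R) (p : plane) : R :=
  let h i j := ip eps (sff eps X i j p) (E3 eps X p) in
  pivR sg (mean_curv_norm eps X p) (h ord0 ord0) (h ord0 ord_max) (h ord_max ord_max)
    (metric eps X p ord0 ord0) (\det (metric eps X p)).

Definition e4F (i : 'I_2) (p : plane) : R :=
  ip eps (nconn eps X i (E3 eps X) p) (nconn eps X i (E3 eps X) p).

Lemma h3_repr i j p : U p -> ip eps (sff eps X i j p) (E3 eps X p) = h3 i j p.
Proof. by move=> Up; rewrite (sff_repr Xx gmu)// e3H_repr// -evv_dot. Qed.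

Lemma piv_repr sg : repr (pivF sg) (piv sg).
Proof.
move=> p Up; transitivity (pivR sg (fH p) (h3 ord0 ord0 p) (h3 ord0 ord_max p)
    (h3 ord_max ord_max p) (gm ord0 ord0 p) ((\det gm) p)).
  rewrite /pivF; congr pivR; [exact: fH_repr|exact: h3_repr|exact: h3_repr|
    exact: h3_repr|exact: metric_repr|exact: det_metric_repr].
rewrite /pivR /piv /eigv /k3 !(sfunDE Up, sfunNE Up, sfunME Up, scstE _ Up).
rewrite (ssqrtE Up asq_gt0) /asq !(sfunDE Up, sfunNE Up, sfunME Up, sfunXE Up).
by rewrite (sfunVE Up)//; apply: positive_nowhere0; exact: (det_gm_gt0 x_sf x_free).
Qed.

Lemma e4_repr i : repr (e4F i) (e4N i).
Proof.
move=> p Up; rewrite /e4F !(nconn_repr Xx gmu i e3H_repr Up) -evv_dot//.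
Qed.

(** The two pivots for the signs 1 and -1 differ by a nonzero function. *)
Lemma exists_piv p : U p -> exists2 sg : R, sg ^+ 2 = 1 & pivF sg p != 0.
Proof.
move=> Up; have g0 := gm00_gt0 x_sf x_free Up.
have s0 := ssqrt_positive asq_gt0 Up.
have E sg : pivF sg p = sg * (ssqrt asq p * gm ord0 ord0 p) - k3 ord0 ord0 p.
  rewrite piv_repr// /piv /eigv !(sfunDE Up, sfunNE Up, sfunME Up, scstE _ Up).
  by rewrite mulrA.
have sg0 := mulr_gt0 s0 g0.
have [p1|] := eqVneq (pivF 1 p) 0; last by exists 1; rewrite ?expr1n.
exists (-1); first by rewrite sqrrN expr1n.
by move: p1; rewrite !E mul1r mulN1r; apply: contra_eqN; lra.
Qed.

Lemma exists_e4 p i : U p -> nconn eps X i (E3 eps X) p != 0 -> e4F i p != 0.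
Proof.
move=> Up; rewrite e4_repr// (nconn_repr Xx gmu i e3H_repr Up) => n0.
by rewrite gt_eqF//; apply: (dot_gt0 x_sf) => //; rewrite dotC ncon_e3H_nv.
Qed.

Lemma E3_normal_field : normal_field eps X U (E3 eps X).
Proof.
split; first exact: vrepr_smooth e3H_repr.
move=> p Up; split=> [|i].
  rewrite Xx// e3H_repr//; apply: (evv_nv_tangent Up).
  by rewrite dotC e3H_nv.
by rewrite e3H_repr// (pdX Xx)// -evv_dot// e3H_xd sfun0E.
Qed.

End Localization.

Lemma open_neq0 (R : realType) (V : domain R) (a : sfun V) :
  open [set p | V p /\ a p != 0].
Proof.
rewrite openE => p [Vp ap].
have nV : nbhs p (V : set _) by exact: open_nbhs_nbhs (conj (dom_open V) Vp).
have na : nbhs p [set q | a q != 0].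
  have ca := differentiable_continuous (sfun_diff a Vp).
  exact: cvgr_neq0 ca ap.
exact: filterI nV na.
Qed.

(** On the open set where the pivot and the normal derivative of E3 in a suitable
direction are nonzero, the adapted frame is smooth. *)
Lemma local_biharmonic_false (R : realType) (eps : R) (X : 'rV[R]_2 -> 'rV[R]_5)
    (V : domain R) :
  local_surface eps X V ->
  (forall p, V p -> exists i, nconn eps X i (E3 eps X) p != 0) ->
  (forall eta, normal_field eps X V eta -> forall p, V p ->
     normal_curv eps X ord0 ord_max eta p = 0) ->
  False.
Proof.
move=> XV E3par flat; have [x Xx] := smooth_vrepr (ls_smooth XV).
have Vp := dom_ptP V; set p := dom_pt V in Vp.
have [sg sg2 sg0] := exists_piv XV Xx Vp.
have [i ni] := E3par p Vp; have i0 := exists_e4 XV Xx Vp ni.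
pose a : sfun V := piv eps x sg * e4N eps x i.
have oU := @open_neq0 R V a.
have aE q : V q -> a q = pivF eps X sg q * e4F eps X i q.
  by move=> Vq; rewrite sfunME// -(piv_repr XV Xx)// -(e4_repr XV Xx).
have Up : V p /\ a p != 0 by split=> //; rewrite aE// mulf_neq0.
pose U := Domain oU Up.
have UV : (U : set _) `<=` V by move=> q [].
have XU := local_surface_sub UV XV.
have [y Xy] := smooth_vrepr (ls_smooth XU).
apply: (@eigen_frame_false R eps X U XU y Xy i sg sg2).
- move=> q Uq; have [Vq] := Uq; rewrite aE// mulf_eq0 negb_or => /andP[nz _].
  by have <- := piv_repr XU Xy sg Uq.
- move=> q Uq; have [Vq] := Uq; rewrite aE// mulf_eq0 negb_or => /andP[_ nz].
  by have <- := e4_repr XU Xy i Uq.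
- by move=> q /UV Vq; apply: (flat _ (E3_normal_field XV Xx)).
Qed.

Theorem theorem4p3 (R : realType) (eps : R) (M : topologicalType)
    (atlas : set (chart R M)) (phi : M -> 'rV[R]_5)
    (surfM : connected_surface atlas)
    (phi_imm : immersion_in_space_form eps atlas phi)
    (phi_nonCMC : nonCMC eps atlas phi)
    (phi_W : W_surface eps atlas phi)
    (phi_flat : flat_normal_bundle eps atlas phi)
    (hfK : everywhere atlas phi (fun X p =>
       3 * mean_curv_norm eps X p ^+ 2 + gauss_curv eps X p - eps != 0))
    (hE3 : E3_nowhere_parallel eps atlas phi)
    (hK : everywhere atlas phi (fun X p => gauss_curv eps X p = eps)) :
  ~ biharmonic eps atlas phi.
Proof.
move=> bih; have [_ _ [x _] _ [cover _]] := surfM.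
have [c cA cx] := cover x; have [phiS phi_smooth phi_free] := phi_imm.
pose V := Domain (@chart_img_open _ _ c) (chart_mapP cx).
apply: (@local_biharmonic_false R eps (phi \o chart_inv c) V).
- split=> [|p Vp|p|p Vp|p Vp|p Vp|p Vp|p Vp].
  + exact: phi_smooth.
  + exact: phiS.
  + exact: phi_free.
  + by have [] := phi_nonCMC c cA p Vp.
  + by have [] := phi_nonCMC c cA p Vp.
  + by have [] := phi_nonCMC c cA p Vp.
  + exact: hK.
  + exact: bih.
- by move=> p Vp; exact: hE3.
- by move=> eta eta_normal p Vp; exact: (phi_flat c cA eta eta_normal).
Qed.
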